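(* Let $G_m$ be a bounded Vilenkin group, let $f\in H_{1/(1+\alpha)}(G_m)$, where $0<\alpha\le 1$, and let $\{q_n:n\ge 0\}$ be a non-increasing sequence of non-negative numbers with $q_0>0$ and $Q_n:=\sum_{k=0}^{n-1}q_k\to\infty$, such that $$\frac{n^{\alpha}}{Q_n}=O(1)\quad\text{as } n\to\infty,\qquad\text{and}\qquad \frac{q_n-q_{n+1}}{n^{\alpha-2}}=O(1)\quad\text{as } n\to\infty .$$ Let $t_nf:=\frac{1}{Q_n}\sum_{k=1}^{n}q_{n-k}S_kf$ be the $n$-th Nörlund mean of $f$ and let $$\widetilde{t}^{\,*}f:=\sup_{n\in\mathbb{N}_+}\frac{|t_nf|}{\log^{1+\alpha}(n+1)} .$$ Then there exists an absolute constant $c_\alpha$, depending only on $\alpha$, such that $$\left\|\widetilde{t}^{\,*}f\right\|_{1/(1+\alpha)}\le c_\alpha\,\|f\|_{H_{1/(1+\alpha)}} .$$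
   Context: $\mathbb{N}_+$ is the set of positive integers and $\mathbb{N}=\mathbb{N}_+\cup\{0\}$. Let $m=(m_0,m_1,\dots)$ be a sequence of integers $m_n\ge 2$ with $\sup_n m_n<\infty$ (bounded case). $Z_{m_n}=\{0,\dots,m_n-1\}$ is the additive group of integers modulo $m_n$. The Vilenkin group $G_m$ is the complete direct product of the $Z_{m_n}$ with the product of discrete topologies; its elements are $x=(x_0,x_1,\dots)$, $x_n\in Z_{m_n}$, and $\mu$ is the normalized Haar measure, i.e. the product of the uniform probability measures on the $Z_{m_n}$. Let $I_0(x):=G_m$ and $I_n(x):=\{y\in G_m: y_0=x_0,\dots,y_{n-1}=x_{n-1}\}$. Put $M_0:=1$, $M_{n+1}:=m_nM_n$. Every $n\in\mathbb{N}$ is uniquely $n=\sum_{k\ge 0}n_kM_k$ with $n_k\in Z_{m_k}$. Let $r_k(x):=\exp(2\pi i x_k/m_k)$; the Vilenkin system is $\psi_n(x):=\prod_{k\ge 0}r_k(x)^{n_k}$. For $0<p<\infty$, $\|f\|_p:=\left(\int_{G_m}|f|^p\,d\mu\right)^{1/p}$. Let $\mathcal F_n$ be the $\sigma$-algebra generated by $\{I_n(x):x\in G_m\}$. A martingale $f=(f^{(n)},n\in\mathbb{N})$ is taken with respect to $(\mathcal F_n)$; its maximal function is $f^*:=\sup_n|f^{(n)}|$, and $H_p(G_m)$ consists of all martingales with $\|f\|_{H_p}:=\|f^*\|_p<\infty$. The Vilenkin–Fourier coefficients of a martingale are $\widehat f(i):=\lim_{k\to\infty}\int_{G_m}f^{(k)}\overline{\psi_i}\,d\mu$,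 and the partial sums are $S_nf:=\sum_{k=0}^{n-1}\widehat f(k)\psi_k$ for $n\in\mathbb{N}_+$.
   Formalization: A constant depending only on α is impossible (take q=(1,ε,ε,…), or m_0→∞); here the constant depends on α, a bound for sup m_n, an upper bound for q_0, and the bounds implied in the two O(1) conditions, and is otherwise uniform in m, q and f. *)

(* Defs.v *)
From HB Require Import structures.
From mathcomp Require Import all_boot all_order all_algebra.
From mathcomp Require Import all_classical all_reals all_analysis.
From mathcomp Require Import complex.

Set Implicit Arguments.
Unset Strict Implicit.
Unset Printing Implicit Defensive.

Import Order.TTheory GRing.Theory Num.Theory.
Import numFieldNormedType.Exports.
Local Open Scope classical_set_scope.
Local Open Scope ring_scope.

(* ['Z_k] is the ring of integers modulo k only for k >= 2; every statement
   about [vilenkin m] assumes 1 < m n for all n. *)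
Definition vilenkin (m : nat -> nat) : Type := forall n : nat, 'Z_(m n).

HB.instance Definition _ (m : nat -> nat) := gen_eqMixin (vilenkin m).
HB.instance Definition _ (m : nat -> nat) := gen_choiceMixin (vilenkin m).
HB.instance Definition _ (m : nat -> nat) :=
  isPointed.Build (vilenkin m) (fun=> 0).

Definition vint (m : nat -> nat) (n : nat) (x : vilenkin m)
  : set (vilenkin m) :=
  [set y | forall k, (k < n)%N -> y k = x k].

(* The sets I_n(x) form a countable base of the product of the discrete
   topologies, so they generate its Borel sigma-algebra. *)
Definition vints (m : nat -> nat) : set (set (vilenkin m)) :=
  [set A | exists n x, A = vint n x].

HB.instance Definition _ (m : nat -> nat) :=
  Measurable.copy (vilenkin m) (g_sigma_algebraType (@vints m)).

(* Product of the uniform probabilities on the factors: the defining property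
   on finite-dimensional rectangles, which determines [mu]. *)
Definition is_haar (R : realType) (m : nat -> nat)
    (mu : probability (vilenkin m) R) : Prop :=
  forall (n : nat) (A : forall k, {set 'Z_(m k)}),
    mu [set x : vilenkin m | forall k, (k < n)%N -> x k \in A k] =
    (\prod_(k < n) (#|A k|%:R / (m k)%:R))%:E.

Definition gen_power (m : nat -> nat) (n : nat) : nat := \prod_(k < n) m k.

Definition digit (m : nat -> nat) (n k : nat) : nat :=
  ((n %/ gen_power m k) %% m k)%N.

Definition expi (R : realType) (t : R) : R[i] := Complex (cos t) (sin t).

Definition rademacher (R : realType) (m : nat -> nat) (k : nat)
    (x : vilenkin m) : R[i] :=
  expi (2 * pi * (x k : nat)%:R / (m k)%:R : R).

(* When all m k >= 2, M_k >= 2 ^ k > n for k > n, so the digits of n, hence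
   the factors of the infinite product, are trivial from k = n.+1 on. *)
Definition psi (R : realType) (m : nat -> nat) (n : nat)
    (x : vilenkin m) : R[i] :=
  \prod_(k < n.+1) rademacher R k x ^+ digit m n k.

Section Martingales.
Variables (R : realType) (m : nat -> nat) (mu : probability (vilenkin m) R).
Implicit Types (h : vilenkin m -> R[i]) (f : nat -> vilenkin m -> R[i]).

Definition cintegral (A : set (vilenkin m)) h : R[i] :=
  Complex (\int[mu]_(x in A) complex.Re (h x)) (\int[mu]_(x in A) complex.Im (h x)).

Definition cintegrable h : Prop :=
  mu.-integrable setT (fun x => (complex.Re (h x))%:E) /\
  mu.-integrable setT (fun x => (complex.Im (h x))%:E).

Definition filtration (n : nat) : set (set (vilenkin m)) :=
  <<s range (@vint m n) >>.

Definition adapted (n : nat) h : Prop :=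
  forall B : set R, measurable B ->
    filtration n ((fun x => complex.Re (h x)) @^-1` B) /\
    filtration n ((fun x => complex.Im (h x)) @^-1` B).

Definition is_martingale f : Prop :=
  [/\ forall n, adapted n (f n),
      forall n, cintegrable (f n) &
      forall n k A, (n <= k)%N -> filtration n A ->
        cintegral A (f k) = cintegral A (f n)].

Definition maximal f (x : vilenkin m) : \bar R :=
  ereal_sup (range (fun n => (Normc.normc (f n x))%:E)).

Definition Hp_norm (p : R) f : \bar R := ('N[mu]_(p%:E)[maximal f])%E.

Definition in_Hp (p : R) f : Prop :=
  is_martingale f /\ (Hp_norm p f < +oo)%E.

Definition fourier_coef f (i : nat) : R[i] :=
  lim ((fun k => cintegral setT (fun x => f k x * conjc (psi R i x)) : R[i]^o)
       @ \oo).

Definition partial_sum f (n : nat) (x : vilenkin m) : R[i] :=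
  \sum_(k < n) fourier_coef f k * psi R k x.

Definition Qsum (q : nat -> R) (n : nat) : R := \sum_(k < n) q k.

Definition norlund_mean (q : nat -> R) f (n : nat) (x : vilenkin m) : R[i] :=
  ((Qsum q n)^-1)%:C%C *
  \sum_(1 <= k < n.+1) (q (n - k)%N)%:C%C * partial_sum f k x.

Definition norlund_maximal (q : nat -> R) (alpha : R) f (x : vilenkin m)
    : \bar R :=
  ereal_sup [set (Normc.normc (norlund_mean q f n x) /
                  (ln n.+1%:R `^ (1 + alpha)))%:E | n in [set n | (0 < n)%N]].

End Martingales.

(* Main.v *)
(* The translation-invariant kernel of the mean of order [n] is dominated by
   n^-alpha * \sum_l M_l^alpha W_l, where W_l is a majorant of the Fejer kernel of
   order M_l: a sum of i consecutive Dirichlet kernels is at most a constant times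
   \sum_l min(i, M_l) W_l, so that Abel summation turns the weights into partial
   sums of q, and these are controlled by the two growth conditions on q.

   A partial sum of order at most M_L only sees the L-th term of the martingale,
   hence everything can be done on the finite group of the first L coordinates
   with constants that do not depend on L, the theorem following by monotone
   convergence.  There the martingale is cut along its jumps between dyadic
   heights, measured by a predictable majorant of its maximal function, into
   finitely many pieces; on each cylinder where it starts, a piece is a multiple
   of an atom.  The means of an atom on a cylinder of level N vanish for n < M_N,
   and the kernel bound gives, outside the cylinder, N + 1 comparable
   contributions to the integral of the p-th power of the maximal function,
   p = 1/(1+alpha), which the p-th power log(n+1) >= c (N + 1) of the weight
   compensates.  Subadditivity of t^p then sums the atoms. *)

Require Import Defs.
From HB Require Import structures.
From mathcomp Require Import all_boot all_order all_algebra.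
From mathcomp Require Import all_classical all_reals all_analysis.
From mathcomp Require Import measurable_realfun complex.
From mathcomp Require Import zify ring lra.

Set Implicit Arguments.
Unset Strict Implicit.
Unset Printing Implicit Defensive.

Import Order.TTheory GRing.Theory Num.Theory.
Import numFieldNormedType.Exports.
Local Open Scope classical_set_scope.
Local Open Scope ring_scope.

(** As p = 1/(1+alpha) is below 1, membership in H_p makes only the p-th power of the maximal
    function integrable. The height used for the cutting is therefore built from the running maximum
    of |f_n|^p: replacing it by a predictable process costs a factor [B] in the average, and this
    loss is harmless only for an integrable quantity. Predictability is what bounds a piece: its
    last increment is the one across the jump, and the value reached there is controlled by the
    height before the jump. The heights are eps * 2^k with an auxiliary eps > 0, because the
    predictable process may vanish; eps disappears only after the estimate on the finite group. The
    two growth conditions pull in opposite directions: n^alpha = O(Q_n) bounds Q_n from below, while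
    the bound on the differences of q bounds Q_N from above for N < n. Together they compare Q_N /
    Q_n with (N/n)^alpha. *)

Local Notation nrm := (@Normc.normc _).

(** * Norms of complex numbers *)

Section ComplexNorm.
Variable R : realType.
Implicit Types z w : R[i].

Lemma normcE z : (nrm z)%:C%C = `|z|.
Proof. by case: z. Qed.

Lemma normc_ge0 z : 0 <= nrm z.
Proof. by case: z => a b; exact: sqrtr_ge0. Qed.

Lemma normcD z w : nrm (z + w) <= nrm z + nrm w.
Proof. by rewrite -lecR rmorphD /= !normcE ler_normD. Qed.

Lemma normcN z : nrm (- z) = nrm z.
Proof. by apply: complexI; rewrite !normcE normrN. Qed.

Lemma normcB z w : nrm (z - w) <= nrm z + nrm w.
Proof. by rewrite -(normcN w) normcD. Qed.

Lemma normc_real (a : R) : 0 <= a -> nrm a%:C%C = a.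
Proof. by move=> a0; apply: complexI; rewrite normcE ger0_norm// lecR. Qed.

Lemma normc_conj z : nrm (conjc z) = nrm z.
Proof. by case: z => a b; rewrite /Normc.normc /= sqrrN. Qed.

Lemma normc_sum (I : Type) (r : seq I) (P : pred I) (F : I -> R[i]) :
  nrm (\sum_(i <- r | P i) F i) <= \sum_(i <- r | P i) nrm (F i).
Proof.
elim/big_ind2: _ => [|x1 x2 y1 y2 h1 h2|//]; first by rewrite Normc.normc0.
by rewrite (le_trans (normcD _ _)) ?lerD.
Qed.

End ComplexNorm.

(** * Kernel estimates *)

Section GenPower.
Variables (m : nat -> nat) (B : nat).
Hypothesis hm : forall n, (2 <= m n <= B)%N.
Local Notation M := (gen_power m).

Lemma gen_power0 : M 0 = 1%N.
Proof. by rewrite /gen_power big_ord0. Qed.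

Lemma gen_powerS n : M n.+1 = (m n * M n)%N.
Proof. by rewrite /gen_power big_ord_recr mulnC. Qed.

Lemma base_ge2 n : (1 < m n)%N.
Proof. by case/andP: (hm n). Qed.

Lemma base_leB n : (m n <= B)%N.
Proof. by case/andP: (hm n). Qed.

Lemma base_gt0 n : (0 < m n)%N.
Proof. exact: ltnW (base_ge2 n). Qed.

Lemma boundB_ge2 : (2 <= B)%N.
Proof. exact: leq_trans (base_ge2 0) (base_leB 0). Qed.

Lemma gen_power_gt0 n : (0 < M n)%N.
Proof. by rewrite prodn_gt0// => i; exact: base_gt0. Qed.

Lemma gen_power_double n : (2 * M n <= M n.+1)%N.
Proof. by rewrite gen_powerS leq_mul2r base_ge2 orbT. Qed.

Lemma gen_powerS_leB n : (M n.+1 <= B * M n)%N.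
Proof. by rewrite gen_powerS leq_mul2r base_leB orbT. Qed.

Lemma gen_power_ltS n : (M n < M n.+1)%N.
Proof. have := gen_power_double n; have := gen_power_gt0 n; lia. Qed.

Lemma leq_gen_power : {mono M : i j / (i <= j)%N}.
Proof. by apply: leq_mono; apply: homo_ltn ltn_trans gen_power_ltS. Qed.

Lemma gen_power_expn n : (2 ^ n <= M n)%N.
Proof.
elim: n => [|n IH]; first by rewrite gen_power0.
by rewrite expnS; apply: leq_trans (gen_power_double n); rewrite leq_mul2l.
Qed.

Lemma ltn_id_gen_power n : (n < M n)%N.
Proof. exact: leq_trans (ltn_expl n (ltnSn 1)) (gen_power_expn n). Qed.

Lemma dvdn_gen_power i j : (i <= j)%N -> (M i %| M j)%N.
Proof.
move=> /subnK <-; elim: (j - i)%N => [|k IH]; first by rewrite add0n.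
by rewrite addSn gen_powerS dvdn_mull.
Qed.

End GenPower.

Section Kernel.
Variables (R : realType) (m : nat -> nat) (B : nat).
Hypothesis hm : forall n, (2 <= m n <= B)%N.
Local Notation M := (gen_power m).

(** The indicator that two points share their first [s] coordinates; multiplied by [M s] it is the
    Dirichlet kernel of order [M s], see [dirichlet_gen_power]. *)
Definition agree (del : nat -> bool) (s : nat) : R := \prod_(j < s) (del j)%:R.

(* Up to constants, the majorant of the Fejer kernel of order [M s], in terms
   of the coordinates on which two points agree. *)
Fixpoint majorant (del : nat -> bool) (s : nat) : R :=
  if s is s'.+1 then
    (del s')%:R * majorant del s' + (M s')%:R * agree del s'
  else 1.

Section Majorant.
Variable del : nat -> bool.
Local Notation ag := (agree del).
Local Notation W := (majorant del).

Lemma agree0 : ag 0 = 1.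
Proof. by rewrite /agree big_ord0. Qed.

Lemma agreeS s : ag s.+1 = (del s)%:R * ag s.
Proof. by rewrite /agree big_ord_recr /= mulrC. Qed.

Lemma agree_ge0 s : 0 <= ag s.
Proof. by rewrite prodr_ge0. Qed.

Lemma agreeS_le s : ag s.+1 <= ag s.
Proof. by rewrite agreeS ler_piMl ?agree_ge0//; case: (del s). Qed.

Lemma majorant_ge0 s : 0 <= W s.
Proof.
by elim: s => //= s IH; rewrite addr_ge0// mulr_ge0// agree_ge0.
Qed.

Lemma agree_le_majorant s : (M s)%:R * ag s <= B%:R * W s.
Proof.
case: s => [|s] /=.
  rewrite gen_power0 agree0 !mulr1 ler_nat.
  exact: leq_trans _ (boundB_ge2 hm).
rewrite mulrDr; apply: ler_wpDl.
  by rewrite mulr_ge0// mulr_ge0// majorant_ge0.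
rewrite mulrA -natrM; apply: ler_pM; rewrite ?agree_ge0 ?agreeS_le//.
by rewrite ler_nat (gen_powerS_leB hm).
Qed.

End Majorant.

(** [e k] abstracts psi_k(x) times the conjugate of psi_k(t), and [del j] the agreement of the
    coordinates [j] of x and t. The four hypotheses are all that the kernel estimates use about
    characters. *)
Variables (e : nat -> R[i]) (del : nat -> bool).
Local Notation ag := (agree del).
Local Notation W := (majorant del).
Hypothesis e_norm : forall k, nrm (e k) = 1.
Hypothesis e0 : e 0%N = 1.
Hypothesis eM : forall s c r, (r < M s)%N -> e (c * M s + r) = e (c * M s) * e r.
Hypothesis e_sum : forall s, \sum_(b < m s) e (b * M s) = (m s * del s)%:R.

Definition dirichlet n : R[i] := \sum_(k < n) e k.
(** Not normalized, so that a window of consecutive Dirichlet kernels is a difference of two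
    values. *)
Definition fejer n : R[i] := \sum_(k < n) dirichlet k.+1.

Local Notation D := dirichlet.
Local Notation F := fejer.

Lemma dirichlet0 : D 0 = 0. Proof. by rewrite /D big_ord0. Qed.
Lemma fejer0 : F 0 = 0. Proof. by rewrite /F big_ord0. Qed.
Lemma dirichletS n : D n.+1 = D n + e n.
Proof. by rewrite /D big_ord_recr. Qed.
Lemma fejerS n : F n.+1 = F n + D n.+1.
Proof. by rewrite {1}/F big_ord_recr. Qed.

Lemma dirichlet_shift s c r : (r <= M s)%N ->
  D (c * M s + r) = D (c * M s) + e (c * M s) * D r.
Proof.
elim: r => [|r IH] rM; first by rewrite addn0 dirichlet0 mulr0 addr0.
by rewrite addnS !dirichletS IH ?(ltnW rM)// eM// mulrDr addrA.
Qed.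

Lemma fejer_shift s c r : (r <= M s)%N ->
  F (c * M s + r) = F (c * M s) + r%:R * D (c * M s) + e (c * M s) * F r.
Proof.
elim: r => [|r IH] rM; first by rewrite addn0 fejer0 mulr0 mul0r !addr0.
rewrite addnS !fejerS IH ?(ltnW rM)// -addnS dirichlet_shift//.
by rewrite -natr1; ring.
Qed.

Lemma dirichlet_mul s a : D (a * M s) = (\sum_(b < a) e (b * M s)) * D (M s).
Proof.
elim: a => [|a IH]; first by rewrite mul0n dirichlet0 big_ord0 mul0r.
by rewrite mulSnr dirichlet_shift// IH big_ord_recr mulrDl.
Qed.

(** Paley's lemma: passing from level s to s+1 multiplies the kernel by a full digit sum, which is
    [m s] or 0. *)
Lemma dirichlet_gen_power s : D (M s) = ((M s)%:R * ag s)%:C%C.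
Proof.
elim: s => [|s IH].
  by rewrite gen_power0 dirichletS dirichlet0 add0r e0 agree0 mulr1 rmorph1.
rewrite gen_powerS dirichlet_mul e_sum IH agreeS !natrM !rmorphM/= !rmorph_nat.
by ring.
Qed.

Lemma normc_nat (n : nat) : nrm (n%:R : R[i]) = n%:R.
Proof. by rewrite -(rmorph_nat (real_complex R)) normc_real. Qed.

Lemma normc_dirichlet_mul s a : (a <= m s)%N ->
  nrm (D (a * M s)) <= (m s)%:R * ((M s)%:R * ag s).
Proof.
move=> am; rewrite dirichlet_mul Normc.normcM dirichlet_gen_power.
have ag0 : 0 <= (M s)%:R * ag s by rewrite mulr_ge0// agree_ge0.
rewrite normc_real// ler_wpM2r//; apply: le_trans (normc_sum _ _ _) _.
under eq_bigr do rewrite e_norm.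
by rewrite sumr_const card_ord ler_nat.
Qed.

(** Each block of length [M s] repeats [F (M s)] up to a unimodular factor and adds [M s] times the
    Dirichlet kernel at its start. The factors are kept as a sum because for a = [m s] it equals
    [m s] times [del s], the cancellation recorded in [majorant]. *)
Lemma fejer_mul s a : (a <= m s)%N ->
  nrm (F (a * M s) - (\sum_(b < a) e (b * M s)) * F (M s)) <=
  a%:R * ((M s)%:R * ((m s)%:R * ((M s)%:R * ag s))).
Proof.
elim: a => [|a IH] am.
  by rewrite mul0n fejer0 big_ord0 mul0r subr0 Normc.normc0 mul0r.
rewrite mulSnr fejer_shift// big_ord_recr /= -[a.+1%:R](natr1 a) [(a%:R + 1) * _]mulrDl mul1r.
have -> : F (a * M s) + (M s)%:R * D (a * M s) + e (a * M s) * F (M s) -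
   (\sum_(b < a) e (b * M s) + e (a * M s)) * F (M s) =
   (F (a * M s) - (\sum_(b < a) e (b * M s)) * F (M s)) + (M s)%:R * D (a * M s).
  by ring.
apply: le_trans (normcD _ _) _; apply: lerD; first by rewrite IH// ltnW.
by rewrite Normc.normcM normc_nat ler_wpM2l// normc_dirichlet_mul// ltnW.
Qed.

Let B1 : 1 <= B%:R :> R.
Proof. by rewrite ler1n; apply: leq_trans (boundB_ge2 hm). Qed.

Let mB s : (m s)%:R <= B%:R :> R.
Proof. by rewrite ler_nat (base_leB hm). Qed.

Lemma normc_fejer_gen_power s : nrm (F (M s)) <= B%:R * ((M s)%:R * W s).
Proof.
elim: s => [|s IH].
  by rewrite gen_power0 fejerS fejer0 dirichletS dirichlet0 !add0r e_norm !mulr1.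
have := fejer_mul (leqnn (m s)); rewrite e_sum -gen_powerS => h.
rewrite -[F _](subrK ((m s * del s)%:R * F (M s))).
apply: le_trans (normcD _ _) _.
rewrite Normc.normcM normc_nat /=.
have ag0 := agree_ge0 del s.
have W0 := majorant_ge0 del s.
have h2 : (m s * del s)%:R * nrm (F (M s)) <=
  (m s * del s)%:R * (B%:R * ((M s)%:R * W s)).
  by rewrite ler_wpM2l.
apply: le_trans (lerD h h2) _.
have h3 : (m s)%:R * ((M s)%:R * ((m s)%:R * ((M s)%:R * ag s))) <=
  B%:R * ((m s)%:R * (M s)%:R * ((M s)%:R * ag s)).
  have -> : (m s)%:R * ((M s)%:R * ((m s)%:R * ((M s)%:R * ag s))) =
    (m s)%:R * ((m s)%:R * (M s)%:R * ((M s)%:R * ag s)) by ring.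
  by rewrite ler_wpM2r// !mulr_ge0.
apply: le_trans (lerD h3 (lexx _)) _; rewrite gen_powerS !natrM.
by rewrite le_eqVlt; apply/orP; left; apply/eqP; ring.
Qed.

(** An incomplete digit sum does not cancel, so it is bounded by its number of terms and the factor
    [del s] is lost. *)
Lemma normc_fejer_mul s a : (a <= m s)%N ->
  nrm (F (a * M s)) <= 2 * B%:R ^+ 3 * ((M s)%:R * W s).
Proof.
move=> am; rewrite -[F _](subrK ((\sum_(b < a) e (b * M s)) * F (M s))).
apply: le_trans (normcD _ _) _.
have h1 := fejer_mul am.
have aB : a%:R <= B%:R :> R by rewrite ler_nat (leq_trans am) ?(base_leB hm).
have h2 : nrm ((\sum_(b < a) e (b * M s)) * F (M s)) <=
    B%:R * (B%:R * ((M s)%:R * W s)).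
  rewrite Normc.normcM; apply: ler_pM; rewrite ?normc_ge0 ?normc_fejer_gen_power//.
  apply: le_trans (normc_sum _ _ _) _.
  under eq_bigr do rewrite e_norm.
  by rewrite sumr_const card_ord.
have ag0 := agree_ge0 del s.
have W0 := majorant_ge0 del s.
have h3 := agree_le_majorant del s.
have h4 : a%:R * ((M s)%:R * ((m s)%:R * ((M s)%:R * ag s))) <=
   B%:R * ((M s)%:R * (B%:R * (B%:R * W s))).
  apply: ler_pM => //; first by rewrite !mulr_ge0.
  by rewrite ler_wpM2l//; apply: ler_pM => //; rewrite mulr_ge0.
have X0 : 0 <= (M s)%:R * W s by rewrite mulr_ge0.
have h5 : B%:R ^+ 2 * ((M s)%:R * W s) <= B%:R ^+ 3 * ((M s)%:R * W s).
  by rewrite ler_wpM2r// ler_weXn2l//.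
apply: le_trans (lerD (le_trans h1 h4) h2) _.
by move: h5; rewrite !exprS expr0; lra.
Qed.

(** The induction on [s] adds one term to each sum: the complete blocks [F (a * M s)] extend the
    first, the products r * D(a * M s), bounded one level higher, the second. *)
Let fejer_bound s := 2 * B%:R ^+ 3 * (\sum_(l < s) (M l)%:R * W l) +
  B%:R ^+ 3 * \sum_(l < s.+1) (M l)%:R * W l.

Let normc_fejer_le_aux s n : (n <= M s)%N -> nrm (F n) <= fejer_bound s.
Proof.
rewrite /fejer_bound.
have B3 : 1 <= B%:R ^+ 3 :> R by rewrite exprn_ege1.
elim: s n => [|s IH] n.
  rewrite gen_power0 big_ord0 big_ord1 gen_power0 /= !mulr1 mulr0 add0r.
  case: n => [_|[_|//]]; first by rewrite fejer0 Normc.normc0; lra.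
  by rewrite fejerS fejer0 dirichletS dirichlet0 !add0r e_norm; lra.
move=> nM; rewrite (divn_eq n (M s)).
set a := (n %/ M s)%N; set r := (n %% M s)%N.
have am : (a <= m s)%N.
  by rewrite /a; have := leq_div2r (M s) nM; rewrite gen_powerS mulnK// (gen_power_gt0 hm).
have rM : (r < M s)%N by rewrite ltn_mod (gen_power_gt0 hm).
rewrite fejer_shift ?(ltnW rM)//.
apply: le_trans (normcD _ _) _; rewrite Normc.normcM e_norm mul1r.
apply: le_trans (lerD (normcD _ _) (lexx _)) _.
rewrite Normc.normcM normc_nat.
have h1 := normc_fejer_mul am.
have W0 := majorant_ge0 del s.
have ag0 := agree_ge0 del s.
have h2 : r%:R * nrm (D (a * M s)) <= B%:R ^+ 3 * ((M s.+1)%:R * W s.+1).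
  have -> : B%:R ^+ 3 * ((M s.+1)%:R * W s.+1) = (M s.+1)%:R * (B%:R ^+ 3 * W s.+1) by ring.
  apply: ler_pM; rewrite ?normc_ge0// ?ler_nat.
    by rewrite ltnW// (ltn_trans rM) ?(gen_power_ltS hm).
  apply: le_trans (normc_dirichlet_mul am) _ => /=.
  rewrite mulrDr; apply: ler_wpDl; first by rewrite !mulr_ge0// ltW// (lt_le_trans _ B3).
  apply: ler_pM => //; first by rewrite mulr_ge0.
  by apply: le_trans (mB s) _; rewrite -[leLHS]expr1 ler_weXn2l.
have h3 := IH r (ltnW rM).
rewrite [X in 2 * _ * X]big_ord_recr [X in _ + _ * X]big_ord_recr /= .
by move: h1 h2 h3; rewrite /=; lra.
Qed.

Lemma normc_fejer_le s n : (n <= M s)%N ->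
  nrm (F n) <= 3 * B%:R ^+ 3 * \sum_(l < s.+1) (M l)%:R * W l.
Proof.
move=> nM; apply: le_trans (normc_fejer_le_aux nM) _; rewrite /fejer_bound.
have B3 : 0 <= B%:R ^+ 3 :> R by rewrite exprn_ge0.
rewrite [X in 2 * _ * X + _ <= _](_ : _ = \sum_(l < s.+1) (M l)%:R * W l - (M s)%:R * W s).
  have : 0 <= B%:R ^+ 3 * ((M s)%:R * W s) by rewrite !mulr_ge0// majorant_ge0.
  lra.
by rewrite big_ord_recr /= addrK.
Qed.

(* Only the blocks of order at least [s] contribute to a Dirichlet kernel whose
   order is a multiple of [M s]. *)
Lemma normc_dirichlet_mul_le s c K : (s <= K)%N -> (c * M s <= M K)%N ->
  nrm (D (c * M s)) <= B%:R ^+ 2 * \sum_(s <= l < K.+1) W l.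
Proof.
move=> sK; rewrite -(subnK sK); elim: (K - s)%N c => [|d IH] c.
  rewrite add0n big_nat1 => cM.
  have c1 : (c <= 1)%N by move: cM (gen_power_gt0 hm s); nia.
  have cm : (c <= m s)%N by rewrite (leq_trans c1) ?(base_gt0 hm).
  apply: le_trans (normc_dirichlet_mul cm) _; rewrite expr2 -mulrA.
  by apply: ler_pM; rewrite ?mulr_ge0 ?agree_ge0// agree_le_majorant.
rewrite addSn gen_powerS => cM.
set t := (d + s)%N in IH cM *.
have st : (s <= t)%N by rewrite leq_addl.
have [k kE] : exists k, M t = (k * M s)%N by apply/dvdnP; exact: (dvdn_gen_power m st).
have k0 : (0 < k)%N by move: (gen_power_gt0 hm t); rewrite kE muln_gt0 => /andP[].
have Ms0 := gen_power_gt0 hm s.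
have -> : (c * M s = (c %/ k) * M t + (c %% k) * M s)%N.
  by rewrite {1}(divn_eq c k) mulnDl kE mulnA.
have r1 : (c %% k * M s < M t)%N by rewrite kE ltn_mul2r Ms0 ltn_mod.
rewrite dirichlet_shift ?(ltnW r1)//.
apply: le_trans (normcD _ _) _; rewrite Normc.normcM e_norm mul1r addrC.
rewrite big_nat_recr /=; last by rewrite leqW.
rewrite mulrDr; apply: lerD; first exact: IH (ltnW r1).
have cm : (c %/ k <= m t)%N.
  move: cM; rewrite kE mulnA leq_mul2r gtn_eqF//= => cM.
  by have := leq_div2r k cM; rewrite mulnK.
apply: le_trans (normc_dirichlet_mul cm) _.
apply: (@le_trans _ _ (B%:R * W t.+1)).
  apply: ler_pM; rewrite ?mulr_ge0 ?agree_ge0//=.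
  by rewrite ler_wpDl// mulr_ge0// majorant_ge0.
by rewrite ler_wpM2r ?majorant_ge0// expr2 ler_peMl// (le_trans _ B1).
Qed.

(* [M s] is the least generalized power above the window length [i], so the
   window meets at most two blocks of length [M s]. *)
Lemma normc_fejer_window n i K : (0 < i <= n)%N -> (n <= M K)%N ->
  nrm (F n - F (n - i)) <=
  11 * B%:R ^+ 4 * \sum_(l < K.+1) (minn i (M l))%:R * W l.
Proof.
move=> /andP[i0 iN] nK.
have exs : exists s, (i <= M s)%N by exists K; exact: leq_trans nK.
case: (ex_minnP exs) => s isM smin.
have sK : (s <= K)%N by apply: smin; exact: leq_trans nK.
(* Minimality of [s] gives M (l-1) < i for 0 < l <= s, hence M l <= B * i; for l = 0 it suffices
   that i >= 1. *)
have Bmin l : (l <= s)%N -> (M l)%:R <= B%:R * (minn i (M l))%:R :> R.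
  move=> ls; rewrite -natrM ler_nat.
  have [|/ltnW Mi] := leqP i (M l); last by move: (boundB_ge2 hm); nia.
  case: l ls => [|l] ls iM; first by rewrite gen_power0 in iM *; move: (boundB_ge2 hm); nia.
  have : (M l < i)%N by rewrite ltnNge; apply/negP => /smin; lia.
  by move: (gen_powerS_leB hm l); nia.
have Mi l : (s <= l)%N -> minn i (M l) = i.
  by move=> sl; apply/minn_idPl; rewrite (leq_trans isM)// (leq_gen_power hm).
set S := \sum_(l < K.+1) _.
have B0 : 0 <= B%:R :> R by [].
have T0 l : 0 <= (minn i (M l))%:R * W l by rewrite mulr_ge0// majorant_ge0.
have S0 : 0 <= S by exact: sumr_ge0.
have SE : S = \sum_(l < s) (minn i (M l))%:R * W l + \sum_(s <= l < K.+1) (minn i (M l))%:R * W l.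
  rewrite /S -!(big_mkord xpredT (fun l => (minn i (M l))%:R * W l)).
  by rewrite -big_cat_nat//= leqW.
have SF : \sum_(l < s.+1) (M l)%:R * W l <= B%:R * S.
  have le1 : \sum_(l < s.+1) (M l)%:R * W l <= B%:R * \sum_(l < s.+1) (minn i (M l))%:R * W l.
    rewrite mulr_sumr; apply: ler_sum => l _.
    by rewrite mulrA ler_wpM2r ?majorant_ge0// Bmin// -ltnS.
  apply: le_trans le1 _; rewrite ler_wpM2l//.
  rewrite SE big_ord_recr /= lerD2l big_ltn ?ltnS// lerDl.
  by apply: sumr_ge0.
have SD : i%:R * \sum_(s <= l < K.+1) W l <= S.
  rewrite SE ler_wpDl ?sumr_ge0// mulr_sumr le_eqVlt; apply/orP; left; apply/eqP.
  by apply: eq_big_nat => l /andP[sl _]; rewrite Mi.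
have FF k : (k <= M s)%N -> nrm (F k) <= 3 * B%:R ^+ 4 * S.
  move=> kM; apply: le_trans (normc_fejer_le kM) _.
  have -> : 3 * B%:R ^+ 4 * S = 3 * B%:R ^+ 3 * (B%:R * S) by ring.
  by rewrite ler_wpM2l// mulr_ge0.
have DD k c : (k <= i)%N -> (c * M s <= M K)%N ->
    nrm (k%:R * D (c * M s)) <= B%:R ^+ 4 * S.
  move=> ki cM; rewrite Normc.normcM normc_nat.
  apply: (@le_trans _ _ (i%:R * (B%:R ^+ 2 * \sum_(s <= l < K.+1) W l))).
    by apply: ler_pM; rewrite ?normc_ge0 ?ler_nat// normc_dirichlet_mul_le.
  rewrite mulrCA; apply: ler_pM => //.
    by rewrite mulr_ge0// sumr_ge0// => l _; exact: majorant_ge0.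
  by rewrite ler_weXn2l.
have Ms0 := gen_power_gt0 hm s.
pose c := (n %/ M s)%N; pose r := (n %% M s)%N.
have nE : n = (c * M s + r)%N by exact: divn_eq.
have rM : (r < M s)%N by rewrite ltn_mod.
have cK : (c * M s <= M K)%N by rewrite (leq_trans _ nK)// nE leq_addr.
have [ir|ri] := leqP i r.
  have -> : (n - i = c * M s + (r - i))%N by lia.
  rewrite nE !fejer_shift ?(ltnW rM)//; last by lia.
  have -> : F (c * M s) + r%:R * D (c * M s) + e (c * M s) * F r -
    (F (c * M s) + (r - i)%:R * D (c * M s) + e (c * M s) * F (r - i)%N) =
    i%:R * D (c * M s) + e (c * M s) * (F r - F (r - i)%N).
    by rewrite natrB//; ring.
  apply: le_trans (normcD _ _) _; rewrite (Normc.normcM (e _)) e_norm mul1r.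
  have h1 := DD i c (leqnn _) cK.
  have h2 := normcB (F r) (F (r - i)%N).
  have h3 := FF r (ltnW rM).
  have h4 : nrm (F (r - i)%N) <= 3 * B%:R ^+ 4 * S by apply: FF; lia.
  have h5 : 0 <= B%:R ^+ 4 * S by rewrite mulr_ge0// ?exprn_ge0.
  lra.
have c0 : (0 < c)%N by lia.
have c1 : (c.-1 * M s <= M K)%N by rewrite (leq_trans _ cK)// leq_mul2r leq_pred orbT.
have -> : (n - i = c.-1 * M s + (M s + r - i))%N.
  by rewrite {1}nE -{1}(prednK c0) mulSn; lia.
have FcE : F (c * M s) =
    F (c.-1 * M s) + (M s)%:R * D (c.-1 * M s) + e (c.-1 * M s) * F (M s).
  by rewrite -fejer_shift// -{1}(prednK c0) mulSnr.
rewrite nE !fejer_shift ?(ltnW rM)//; last by lia.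
rewrite FcE.
set x := (M s + r - i)%N.
have xE : (M s)%:R - x%:R = (i - r)%:R :> R[i].
  by rewrite -natrB; [congr (_%:R); rewrite /x; lia | rewrite /x; lia].
have -> : F (c.-1 * M s) + (M s)%:R * D (c.-1 * M s) + e (c.-1 * M s) * F (M s) +
    r%:R * D (c * M s) + e (c * M s) * F r -
    (F (c.-1 * M s) + x%:R * D (c.-1 * M s) + e (c.-1 * M s) * F x) =
  r%:R * D (c * M s) + e (c * M s) * F r + (i - r)%:R * D (c.-1 * M s)
   + e (c.-1 * M s) * (F (M s) - F x).
  by rewrite -xE; ring.
have h1 := DD r c (ltnW ri) cK.
have h2 := DD (i - r)%N c.-1 (leq_subr _ _) c1.
have h3 := FF r (ltnW rM).
have h4 : nrm (F x) <= 3 * B%:R ^+ 4 * S by apply: FF; rewrite /x; lia.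
have h5 := FF (M s) (leqnn _).
have h6 := normcB (F (M s)) (F x).
(* Two Dirichlet terms at cost 1 and three Fejer terms at cost 3 give the constant 11; a window
   inside one block only needs 7. *)
apply: le_trans (normcD _ _) _.
apply: le_trans (lerD (normcD _ _) (lexx _)) _.
apply: le_trans (lerD (lerD (normcD _ _) (lexx _)) (lexx _)) _.
rewrite !(Normc.normcM (e _)) !e_norm !mul1r.
lra.
Qed.

(** The windows are anchored at the top order [n]: since [q i] is the weight of [D (n - i)], the
    first j weights meet exactly the kernels summed in [F n - F (n - j)]. *)
Let abel_fejer (q : nat -> R) n j : (j <= n)%N ->
  \sum_(i < j) (q i)%:C%C * D (n - i) =
  \sum_(i < j) (q i - q i.+1)%:C%C * (F n - F (n - i.+1)) +
    (q j)%:C%C * (F n - F (n - j)).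
Proof.
elim: j => [|j IH] jn; first by rewrite !big_ord0 subn0 subrr mulr0 addr0.
rewrite !big_ord_recr /= IH ?(ltnW jn)//.
have -> : F (n - j) = F (n - j.+1) + D (n - j).
  by rewrite -[in F (n - j)](subnSK jn) fejerS subnSK.
by rewrite rmorphB /=; ring.
Qed.

Let abel_minn (q : nat -> R) N j :
  \sum_(i < j) (q i - q i.+1) * (minn i.+1 N)%:R + q j * (minn j N)%:R =
  Qsum q (minn j N).
Proof.
elim: j => [|j IH]; first by rewrite min0n big_ord0 mulr0 /Qsum big_ord0 addr0.
have [Nj|jN] := leqP N j.
  rewrite big_ord_recr /= !(minn_idPr _) ?leqW//.
  by move: IH; rewrite (minn_idPr Nj) => <-; ring.
move: IH; rewrite big_ord_recr /= !(minn_idPl _) ?(ltnW jN)// => IH.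
by rewrite [in RHS]/Qsum big_ord_recr /= -/(Qsum q j) -IH -natr1; ring.
Qed.

(* After an Abel summation the window bounds carry the weights
   [minn i (M l)], and undoing the summation turns these into partial sums of
   [q]; this is where the monotonicity of [q] enters. *)
Lemma normc_norlund_kernel_le (q : nat -> R) n K : nonincreasing_seq q ->
  (forall n, 0 <= q n) -> (n <= M K)%N ->
  nrm (\sum_(1 <= k < n.+1) (q (n - k)%N)%:C%C * D k) <=
  11 * B%:R ^+ 4 * \sum_(l < K.+1) Qsum q (minn n (M l)) * W l.
Proof.
move=> qdec q0 nK.
have -> : \sum_(1 <= k < n.+1) (q (n - k)%N)%:C%C * D k =
    \sum_(i < n) (q i)%:C%C * D (n - i).
  rewrite big_add1 /= big_mkord (reindex_inj rev_ord_inj) /=.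
  apply: eq_bigr => i _.
  have -> : (n - (n - i.+1).+1 = i)%N by have := ltn_ord i; lia.
  by have -> : ((n - i.+1).+1 = n - i)%N by have := ltn_ord i; lia.
have dq i : 0 <= q i - q i.+1 by rewrite subr_ge0 qdec.
have win i : (0 < i <= n)%N -> nrm (F n - F (n - i)) <=
    11 * B%:R ^+ 4 * \sum_(l < K.+1) (minn i (M l))%:R * W l.
  by move=> i0; apply: normc_fejer_window.
rewrite abel_fejer//.
apply: (@le_trans _ _ (\sum_(i < n) (q i - q i.+1) *
    (11 * B%:R ^+ 4 * \sum_(l < K.+1) (minn i.+1 (M l))%:R * W l) +
    q n * (11 * B%:R ^+ 4 * \sum_(l < K.+1) (minn n (M l))%:R * W l))).
  apply: le_trans (normcD _ _) _; apply: lerD.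
    apply: le_trans (normc_sum _ _ _) _; apply: ler_sum => i _.
    by rewrite Normc.normcM normc_real// ler_wpM2l// win /=.
  rewrite Normc.normcM normc_real//; have [->|n0] := posnP n.
    rewrite subnn subrr Normc.normc0 mulr0 mulr_ge0// mulr_ge0//.
    by apply: sumr_ge0 => l _; rewrite mulr_ge0// majorant_ge0.
  by rewrite ler_wpM2l// win// n0 leqnn.
rewrite le_eqVlt; apply/orP; left; apply/eqP.
under [in RHS]eq_bigr do rewrite -abel_minn mulrDl mulr_suml.
rewrite big_split /= mulrDr; congr (_ + _).
  rewrite exchange_big /= mulr_sumr; apply: eq_bigr => i _.
  by rewrite mulrCA !mulr_sumr; apply: eq_bigr => l _; ring.
by rewrite mulrCA !mulr_sumr; apply: eq_bigr => l _; ring.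
Qed.

End Kernel.

(** * Vilenkin characters *)

Section Characters.
Variable R : realType.
Implicit Types t : R.

Lemma expiD s t : expi (s + t) = expi s * expi t.
Proof. by apply/eqP; rewrite eq_complex /= cosD sinD addrC eqxx/= addrC mulrC. Qed.

Lemma expi0 : expi (0 : R) = 1.
Proof. by rewrite /expi cos0 sin0. Qed.

Lemma conj_expi t : conjc (expi t) = expi (- t).
Proof. by rewrite /expi cosN sinN. Qed.

Lemma normc_expi t : nrm (expi t) = 1.
Proof. by rewrite /Normc.normc /= cos2Dsin2 sqrtr1. Qed.

Lemma expiMn t n : expi (t *+ n) = expi t ^+ n.
Proof. by elim: n => [|n IH]; rewrite ?expi0// mulrS exprS expiD IH. Qed.

Lemma expi_2pi : expi (2 * pi : R) = 1.
Proof. by rewrite mulr_natl /expi cos2pi sin2pi. Qed.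

(** By cos s = 1 - 2 sin(s/2)^2, a value 1 forces sin(s/2) = 0, impossible for 0 < s < 2 pi;
    negative arguments reduce to this by conjugation. *)
Lemma expi_eq1 t : expi t = 1 -> `|t| < 2 * pi -> t = 0.
Proof.
have pos (s : R) : expi s = 1 -> 0 < s -> s < 2 * pi -> False.
  move=> es s0 s2.
  have c1 : cos s = 1 by case: es.
  have : 0 < sin (s / 2) by apply: sin_gt0_pi; lra.
  have : cos s = 1 - 2 * sin (s / 2) ^+ 2.
    rewrite [in LHS](_ : s = (s / 2) *+ 2); last by rewrite -mulr_natr; lra.
    by rewrite cos_mulr2n cos2sin2; ring.
  rewrite c1 => h sp.
  have : sin (s / 2) ^+ 2 = 0 by lra.
  by move/eqP; rewrite sqrf_eq0 gt_eqF.
move=> et; case: (ltgtP t 0) => // t0.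
  rewrite ltr0_norm// => t2; exfalso.
  apply: (pos (- t)) => //; last by lra.
  by rewrite -conj_expi et conjc1.
by rewrite gtr0_norm// => t2; exfalso; exact: (pos t).
Qed.

Variables (m : nat -> nat) (B : nat).
Hypothesis hm : forall n, (2 <= m n <= B)%N.
Local Notation M := (gen_power m).
Implicit Types x y : vilenkin m.

Lemma ltn_coord s x : (x s < m s)%N.
Proof. by apply: leq_trans (ltn_ord (x s)) _; rewrite Zp_cast// (base_ge2 hm). Qed.

Lemma normc_exp (z : R[i]) n : nrm (z ^+ n) = nrm z ^+ n.
Proof.
by elim: n => [|n IH]; rewrite ?expr0 ?Normc.normc1// !exprS Normc.normcM IH.
Qed.

Lemma normc_psi n x : nrm (psi R n x) = 1.
Proof.
rewrite /psi; elim/big_rec: _ => [|k z _ IH]; first exact: Normc.normc1.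
by rewrite Normc.normcM IH normc_exp normc_expi expr1n mulr1.
Qed.

Lemma digit_small n k : (n < M k)%N -> digit m n k = 0%N.
Proof. by move=> nM; rewrite /digit divn_small// mod0n. Qed.

Lemma digit_shift_ge s c r k : (r < M s)%N -> (s <= k)%N ->
  digit m (c * M s + r) k = digit m (c * M s) k.
Proof.
move=> rM sk; have /dvdnP[u uE] := dvdn_gen_power m sk.
have Ms := gen_power_gt0 hm s.
by rewrite /digit uE [(u * _)%N]mulnC !divnMA divnMDl// mulnK// [(r %/ _)%N]divn_small// ?addn0.
Qed.

Lemma digit_shift_lt s c r k : (k < s)%N ->
  digit m (c * M s + r) k = digit m r k.
Proof.
move=> ks; have /dvdnP[u ->] := dvdn_gen_power m ks.
have Mk := gen_power_gt0 hm k.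
by rewrite /digit gen_powerS !mulnA divnMDl// modnMDl.
Qed.

Lemma digit_mul_lt s c k : (k < s)%N -> digit m (c * M s) k = 0%N.
Proof.
by move=> ks; rewrite -[(c * _)%N]addn0 digit_shift_lt// /digit div0n mod0n.
Qed.

Lemma psi_widen n K x : (n < M K)%N ->
  psi R n x = \prod_(k < K) rademacher R k x ^+ digit m n k.
Proof.
move=> nM; have aux a b : (n < M a)%N -> (a <= b)%N ->
  \prod_(k < b) rademacher R k x ^+ digit m n k =
  \prod_(k < a) rademacher R k x ^+ digit m n k.
  move=> nMa /subnK <-; elim: (b - a)%N => [|d IH]//.
  rewrite addSn big_ord_recr /= IH digit_small ?mulr1//.
  by apply: leq_trans nMa _; rewrite (leq_gen_power hm) leq_addl.
rewrite /psi; have [Kn|nK] := leqP K n.+1; first exact: aux.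
apply/esym/aux; last exact: ltnW.
exact: ltn_trans (ltnSn n) (ltn_id_gen_power hm _).
Qed.

(** No carry occurs: the nonzero digits of [c * M s] sit at positions at least [s], those of [r]
    below [s]. *)
Lemma psi_shift s c r x : (r < M s)%N ->
  psi R (c * M s + r) x = psi R (c * M s) x * psi R r x.
Proof.
move=> rM; pose K := (c * M s + r).+1.
have nK : (c * M s + r < M K)%N.
  exact: ltn_trans (ltnSn _) (ltn_id_gen_power hm _).
rewrite !(@psi_widen _ K)//.
- rewrite -big_split /=; apply: eq_bigr => k _; rewrite -exprD; congr (_ ^+ _).
  have [sk|ks] := leqP s k.
    rewrite digit_shift_ge// (digit_small (n := r)) ?addn0//.
    by rewrite (leq_trans rM) ?(leq_gen_power hm).
  by rewrite digit_shift_lt// digit_mul_lt.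
- by rewrite (leq_ltn_trans _ nK)// leq_addl.
- by rewrite (leq_ltn_trans _ nK)// leq_addr.
Qed.

Lemma psi_mul s b x : (b < m s)%N ->
  psi R (b * M s) x = rademacher R s x ^+ b.
Proof.
move=> bm.
rewrite (@psi_widen _ s.+1); last by rewrite gen_powerS ltn_mul2r (gen_power_gt0 hm).
rewrite big_ord_recr /= /digit mulnK ?(gen_power_gt0 hm)// modn_small//.
rewrite big1 ?mul1r// => k _; rewrite -/(digit m (b * M s) k) digit_mul_lt ?expr0//.
Qed.

Lemma psi0 x : psi R 0 x = 1.
Proof. by rewrite /psi big_ord1 digit_small ?expr0// gen_power0. Qed.

(** A geometric sum of an [m s]-th root of unity [z]. If the coordinates differ, the angle of [z] is
    nonzero and smaller than a full turn, so [z] is not 1 and the sum vanishes. *)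
Lemma sum_psi_mul s x y :
  \sum_(b < m s) psi R (b * M s) x * conjc (psi R (b * M s) y) =
  (m s * (x s == y s))%:R.
Proof.
set z := rademacher R s x * conjc (rademacher R s y).
under eq_bigr => b _ do rewrite psi_mul// psi_mul// rmorphXn -exprMn -/z.
have m0 : (m s)%:R != 0 :> R by rewrite pnatr_eq0 -lt0n (base_gt0 hm).
have zE : z = expi (2 * pi * ((x s : nat)%:R - (y s : nat)%:R) / (m s)%:R).
  by rewrite /z /rademacher conj_expi -expiD; congr expi; ring.
have ltm (w : vilenkin m) : (w s < m s)%N by exact: ltn_coord.
have [xy|xy] := eqVneq (x s) (y s).
  rewrite muln1; under eq_bigr do rewrite zE xy subrr mulr0 mul0r expi0 expr1n.
  by rewrite sumr_const card_ord.
rewrite muln0.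
have z1 : z != 1.
  apply/eqP; rewrite zE => /expi_eq1.
  have mp : 0 < (m s)%:R :> R by rewrite lt0r m0 ler0n.
  have [xl yl] : (x s : nat)%:R < (m s)%:R :> R /\ (y s : nat)%:R < (m s)%:R :> R.
    by rewrite !ltr_nat; split; exact: ltm.
  have [x0 y0] : 0 <= (x s : nat)%:R :> R /\ 0 <= (y s : nat)%:R :> R by [].
  have p2 : 0 < 2 * pi :> R by rewrite mulr_gt0 ?pi_gt0.
  have h1 : `|2 * pi * ((x s : nat)%:R - (y s : nat)%:R) / (m s)%:R| < 2 * pi :> R.
    rewrite -mulrA normrM gtr0_norm// -[ltRHS]mulr1 ltr_pM2l//.
    rewrite normrM normfV (gtr0_norm mp) ltr_pdivrMr// mul1r ltr_norml.
    by apply/andP; split; lra.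
  move=> /(_ h1)/eqP; rewrite !mulf_eq0 invr_eq0 (negPf m0) orbF (gt_eqF (pi_gt0 R)) pnatr_eq0 /=.
  by rewrite subr_eq0 eqr_nat => /eqP/val_inj/eqP; rewrite (negPf xy).
have zm : z ^+ m s = 1.
  rewrite /z exprMn -rmorphXn /rademacher -!expiMn.
  have e1 (w : vilenkin m) : expi ((2 * pi * (w s : nat)%:R / (m s)%:R : R) *+ m s) = 1.
    have -> : (2 * pi * (w s : nat)%:R / (m s)%:R : R) *+ m s = (2 * pi) *+ (w s : nat).
      by rewrite -[LHS]mulr_natr -[RHS]mulr_natr mulfVK.
    by rewrite expiMn expi_2pi expr1n.
  by rewrite !e1 rmorph1 mulr1.
have := subrX1 z (m s); rewrite zm subrr => /esym/eqP.
by rewrite mulf_eq0 subr_eq0 (negPf z1) /= => /eqP.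
Qed.

End Characters.

(** * Powers and weights *)

Section Powers.
Variable R : realType.
Implicit Types a b p alpha : R.

Lemma one_powR a : 1 `^ a = 1 :> R.
Proof. by rewrite powR1. Qed.

(** The ratios a/(a+b) and b/(a+b) lie in [0,1], so each is at most its p-th power, and they add up
    to 1. *)
Lemma powR_addr_le a b p : 0 <= a -> 0 <= b -> 0 < p <= 1 ->
  (a + b) `^ p <= a `^ p + b `^ p.
Proof.
move=> a0 b0 /andP[p0 p1].
have [->|aN0] := eqVneq a 0; first by rewrite powR0 ?gt_eqF// !add0r.
have [->|bN0] := eqVneq b 0; first by rewrite powR0 ?gt_eqF// !addr0.
have {}a0 : 0 < a by rewrite lt0r aN0.
have {}b0 : 0 < b by rewrite lt0r bN0.
have s0 : 0 < a + b by rewrite addr_gt0.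
have sN0 : a + b != 0 by rewrite gt_eqF.
have frac x : 0 < x -> x <= a + b -> x / (a + b) * (a + b) `^ p <= x `^ p.
  move=> x0 xs; rewrite -[in leRHS](divfK sN0 x) powRM; [|by rewrite ltW ?divr_gt0|exact: ltW].
  rewrite ler_wpM2r ?powR_ge0// ger1_powR// divr_gt0//=.
  by rewrite ler_pdivrMr// mul1r.
have ha := frac a a0; have hb := frac b b0.
rewrite -[leLHS]mul1r -(divff sN0) [in X in X * _]mulrDl mulrDl.
by apply: lerD; [apply: ha | apply: hb]; lra.
Qed.

Lemma powR_sum_le (I : Type) (r : seq I) (P : pred I) (F : I -> R) p :
  0 < p <= 1 -> (forall i, P i -> 0 <= F i) ->
  (\sum_(i <- r | P i) F i) `^ p <= \sum_(i <- r | P i) F i `^ p.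
Proof.
move=> p01 F0; have p0 : p != 0 by case/andP: p01 => p0 _; rewrite gt_eqF.
suff : 0 <= \sum_(i <- r | P i) F i /\
  (\sum_(i <- r | P i) F i) `^ p <= \sum_(i <- r | P i) F i `^ p by case.
elim/big_rec2: _ => [|i y x Pi [x0 xy]]; first by rewrite powR0.
split; first by rewrite addr_ge0// F0.
by rewrite (le_trans (powR_addr_le _ _ p01)) ?F0// lerD2l.
Qed.

(** Bernoulli's inequality for nonpositive exponents: ln a <= a - 1 is reversed by [p], then exp u
    >= 1 + u. *)
Lemma powR_ge_tangent a p : 0 < a -> p <= 0 -> 1 + p * (a - 1) <= a `^ p.
Proof.
move=> a0 p0; rewrite /powR gt_eqF//.
apply: le_trans (expR_ge1Dx _); rewrite lerD2l ler_wnM2l//.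
by have := @le_ln1Dx R (a - 1); rewrite [1 + _]addrC subrK; apply; lra.
Qed.

Lemma powR_subr1E a x : 0 < x -> x `^ (a - 1) = x `^ a / x.
Proof.
by move=> x0; rewrite powRB ?(powRr1 (ltW x0))//; apply/implyP => _; rewrite gt_eqF.
Qed.

(** Makes the bound on the differences of [q] telescope. The tangent inequality gives the difference
    quotient at j+1; replacing j+1 by j costs 2^(2-alpha) <= 4. The constant blows up at alpha = 1,
    a case treated apart in [Qsum_minn_le]. *)
Lemma powR_subr2_le alpha (j : nat) : 0 < alpha < 1 -> (0 < j)%N ->
  j%:R `^ (alpha - 2) <=
  4 / (1 - alpha) * (j%:R `^ (alpha - 1) - j.+1%:R `^ (alpha - 1)).
Proof.
move=> /andP[al0 al1] j0; set x : R := j%:R; set y : R := j.+1%:R.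
have x0 : 0 < x by rewrite ltr0n.
have y0 : 0 < y by rewrite ltr0n.
have yx : y = x + 1 by rewrite /y -natr1.
have x1 : 1 <= x by rewrite ler1n.
have h1 : y `^ (alpha - 1) + (1 - alpha) * y `^ (alpha - 2) <= x `^ (alpha - 1).
  have -> : x `^ (alpha - 1) = y `^ (alpha - 1) * (x / y) `^ (alpha - 1).
    by rewrite -powRM ?divr_ge0 ?ltW// mulrC divfK ?gt_eqF.
  have -> : y `^ (alpha - 2) = y `^ (alpha - 1) / y.
    by rewrite -powR_subr1E//; congr (_ `^ _); ring.
  have -> : y `^ (alpha - 1) + (1 - alpha) * (y `^ (alpha - 1) / y) =
    y `^ (alpha - 1) * (1 + (alpha - 1) * (x / y - 1)).
    by rewrite yx; field; rewrite -yx gt_eqF.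
  by rewrite ler_wpM2l ?powR_ge0// powR_ge_tangent ?divr_gt0//; lra.
have h2 : x `^ (alpha - 2) <= 4 * y `^ (alpha - 2).
  have y2 : y <= 2 * x by lra.
  have -> : alpha - 2 = - (2 - alpha) by ring.
  rewrite !powRN -ler_pdivrMl// -invfM lef_pV2 ?posrE ?mulr_gt0 ?powR_gt0//.
  apply: (@le_trans _ _ ((2 * x) `^ (2 - alpha))).
    by apply: ge0_ler_powR; rewrite ?nnegrE; lra.
  rewrite powRM; [|by []|exact: ltW]; rewrite ler_wpM2r ?powR_ge0//.
  have -> : 4 = 2 `^ 2 :> R by rewrite powR_mulrn//; ring.
  by rewrite ler_powR; lra.
rewrite mulrAC ler_pdivlMr ?subr_gt0//.
have : x `^ (alpha - 2) * (1 - alpha) <= 4 * y `^ (alpha - 2) * (1 - alpha).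
  by rewrite ler_wpM2r// subr_ge0 ltW.
by move: h1; lra.
Qed.

Lemma powR_subr1_le alpha (i : nat) : 0 < alpha <= 1 ->
  i.+1%:R `^ (alpha - 1) <= 2 / alpha * (i.+1%:R `^ alpha - i%:R `^ alpha).
Proof.
move=> /andP[al0 al1]; have [->|i0] := posnP i.
  by rewrite powR0 ?gt_eqF// !powR1 subr0 mulr1 ler_pdivlMr//; lra.
set y : R := i.+1%:R; set x : R := i%:R.
have x0 : 0 < x by rewrite ltr0n.
have y0 : 0 < y by rewrite ltr0n.
have yx : y = x + 1 by rewrite /y -natr1.
have x1 : 1 <= x by rewrite ler1n.
have -> : x `^ alpha = y `^ alpha * (x / y) `^ alpha.
  by rewrite -powRM ?divr_ge0 ?ltW// mulrC divfK ?gt_eqF.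
have -> : y `^ (alpha - 1) = y `^ alpha * y^-1.
  exact: powR_subr1E.
rewrite -[y `^ alpha - _](_ : y `^ alpha * (1 - (x / y) `^ alpha) = _); last by ring.
rewrite mulrCA ler_wpM2l ?powR_ge0//.
have t1 : 1 + alpha / y <= (x / y) `^ (- alpha).
  apply: le_trans (powR_ge_tangent _ _); rewrite ?divr_gt0//; last by lra.
  by rewrite le_eqVlt; apply/orP; left; apply/eqP; rewrite yx; field; rewrite -yx gt_eqF.
have ay : 0 < alpha / y by rewrite divr_gt0.
have ay1 : alpha / y <= 1 by rewrite ler_pdivrMr//; lra.
have t2 : (x / y) `^ alpha <= (1 + alpha / y)^-1.
  by rewrite -[leLHS]invrK -powRN lef_pV2 ?posrE ?powR_gt0 ?divr_gt0// addr_gt0.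
apply: (@le_trans _ _ (2 / alpha * (alpha / y / 2))).
  by rewrite le_eqVlt; apply/orP; left; apply/eqP; field; rewrite !gt_eqF.
rewrite ler_wpM2l//; first by rewrite divr_ge0// ltW.
apply: le_trans (lerB (lexx 1) t2).
set u := alpha / y in ay ay1 *.
have -> : 1 - (1 + u)^-1 = u / (1 + u) by field; lra.
by rewrite (ler_wpM2l (ltW ay))// lef_pV2 ?posrE//; lra.
Qed.

Lemma sum_powR_le alpha n : 0 < alpha <= 1 ->
  \sum_(i < n) i.+1%:R `^ (alpha - 1) <= 2 / alpha * n%:R `^ alpha.
Proof.
move=> a01; have /andP[a0 _] := a01; elim: n => [|n IH].
  by rewrite big_ord0 powR0 ?mulr0// gt_eqF.
rewrite big_ord_recr /=; have := powR_subr1_le n a01.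
by move: IH; rewrite mulrBr; lra.
Qed.

End Powers.

(** * Comparison of the partial sums of q *)

Section Weights.
Variables (R : realType) (alpha C0 C1 C2 : R).
Hypothesis a01 : 0 < alpha <= 1.

(** [C0] pays for [q 0], or for all weights when alpha = 1, the conditional term for the differences
    of [q], and the final 1 for the part [N * q n] of Q_N. Absolute values appear because the three
    bounds carry no sign assumption. *)
Definition weight_const : R :=
  (`|C0| + (if alpha < 1 then `|C2| * (4 / (1 - alpha)) * (2 / alpha) else 0)) * `|C1| + 1.

Lemma weight_const_ge1 : 1 <= weight_const.
Proof.
have /andP[a0 a1] := a01.
rewrite /weight_const ler_wpDl// mulr_ge0// addr_ge0//; case: ifP => // al.
by rewrite !mulr_ge0// ?invr_ge0; lra.
Qed.

Variable q : nat -> R.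
Hypothesis qdec : nonincreasing_seq q.
Hypothesis q_ge0 : forall n, 0 <= q n.
Hypothesis q0 : 0 < q 0%N.
Hypothesis q0C : q 0%N <= C0.
Hypothesis hQO : forall n, (0 < n)%N -> n%:R `^ alpha / Qsum q n <= C1.
Hypothesis hqO : forall n, (0 < n)%N ->
  (q n - q n.+1) / (n%:R `^ (alpha - 2)) <= C2.

Lemma Qsum_gt0 n : (0 < n)%N -> 0 < Qsum q n.
Proof.
case: n => // n _; rewrite /Qsum big_ord_recl ltr_pwDl//.
exact: sumr_ge0.
Qed.

Lemma natM_le_Qsum n : n%:R * q n <= Qsum q n.
Proof.
rewrite /Qsum -[n in n%:R](card_ord n) -sumr_const mulr_suml; apply: ler_sum => i _.
by rewrite mul1r; apply: qdec; exact: ltnW (ltn_ord i).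
Qed.

Lemma powR_le_Qsum n : (0 < n)%N -> n%:R `^ alpha <= `|C1| * Qsum q n.
Proof.
move=> n0; have := hQO n0; rewrite ler_pdivrMr ?Qsum_gt0// => h.
by apply: le_trans h _; rewrite ler_wpM2r ?ler_norm// ltW// Qsum_gt0.
Qed.

(** The comparison is with [q n] and not with 0, since [q] may have a positive limit. *)
Lemma seq_diff_le i n : alpha < 1 -> (0 < i <= n)%N ->
  q i - q n <= `|C2| * (4 / (1 - alpha)) * i%:R `^ (alpha - 1).
Proof.
move=> al1 /andP[i0 iN]; have /andP[a0 _] := a01.
have K0 : 0 <= `|C2| * (4 / (1 - alpha)) by rewrite mulr_ge0// divr_ge0//; lra.
suff : q i - q n <=
    `|C2| * (4 / (1 - alpha)) * (i%:R `^ (alpha - 1) - n%:R `^ (alpha - 1)).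
  move=> h; apply: le_trans h _; rewrite ler_wpM2l// gerBl powR_ge0//.
rewrite -(subnK iN); elim: (n - i)%N => [|d IH].
  by rewrite add0n !subrr mulr0.
rewrite addSn; set j := (d + i)%N in IH *.
have j0 : (0 < j)%N by rewrite (leq_trans i0)// leq_addl.
have := hqO j0; rewrite ler_pdivrMr ?powR_gt0 ?ltr0n// => h1.
have h2 : q j - q j.+1 <= `|C2| * (4 / (1 - alpha)) *
    (j%:R `^ (alpha - 1) - j.+1%:R `^ (alpha - 1)).
  apply: le_trans h1 _; rewrite -mulrA.
  apply: (@le_trans _ _ (`|C2| * j%:R `^ (alpha - 2))).
    by rewrite ler_wpM2r ?powR_ge0// ler_norm.
  by rewrite ler_wpM2l// powR_subr2_le// a0.
rewrite -[leLHS](subrKA (q j)); move: IH h2; lra.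
Qed.

(** If n <= N the ratio is at least 1. Otherwise write q_i = (q_i - q_n) + q_n: the differences,
    together with q_0, sum to O(N^alpha) = O((N/n)^alpha n^alpha), absorbed by n^alpha <= C1 Q_n.
    Monotonicity gives N q_n <= (N/n) Q_n, and N/n <= (N/n)^alpha. *)
Lemma Qsum_minn_le n N : (0 < n)%N -> (0 < N)%N ->
  Qsum q (minn n N) <= weight_const * (N%:R / n%:R) `^ alpha * Qsum q n.
Proof.
have /andP[a0 a1] := a01; move=> n0 N0.
have W1 := weight_const_ge1.
have np : 0 < n%:R :> R by rewrite ltr0n.
have Np : 0 < N%:R :> R by rewrite ltr0n.
have Qn0 := Qsum_gt0 n0.
have [nN|/ltnW Nn] := leqP n N.
  rewrite -[leLHS]mul1r; apply: ler_wpM2r; first exact: ltW.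
  have h1 : 1 <= (N%:R / n%:R) `^ alpha.
    rewrite -[leLHS](one_powR alpha); apply: ge0_ler_powR; rewrite ?nnegrE ?divr_ge0 ?(ltW a0)//.
    by rewrite ler_pdivlMr// mul1r ler_nat.
  by rewrite -[leLHS]mul1r; apply: ler_pM.
have NE : N%:R `^ alpha = (N%:R / n%:R) `^ alpha * n%:R `^ alpha.
  by rewrite -powRM ?divr_ge0// divfK ?gt_eqF.
have Nn1 : N%:R / n%:R <= (N%:R / n%:R) `^ alpha.
  by rewrite ger1_powR// divr_gt0//= ler_pdivrMr// mul1r ler_nat.
have hP := powR_le_Qsum n0.
have N1 : 1 <= N%:R `^ alpha.
  by rewrite -[leLHS](one_powR alpha); apply: ge0_ler_powR; rewrite ?nnegrE ?ler1n// ltW.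
set r := (N%:R / n%:R) `^ alpha in NE Nn1 *.
have r0 : 0 <= r by exact: powR_ge0.
have C00 : q 0%N <= `|C0| by rewrite (le_trans q0C)// ler_norm.
suff h : Qsum q N <= (`|C0| + (if alpha < 1 then
    `|C2| * (4 / (1 - alpha)) * (2 / alpha) else 0)) * N%:R `^ alpha + N%:R * q n.
  apply: le_trans h _; rewrite /weight_const.
  set K := `|C0| + _.
  have K0 : 0 <= K.
    rewrite /K addr_ge0//; case: ifP => // al.
    by rewrite !mulr_ge0// ?invr_ge0; lra.
  rewrite [(_ + 1) * r]mulrDl mul1r [(_ + r) * Qsum q n]mulrDl; apply: lerD.
    by rewrite NE -!mulrA ler_wpM2l// mulrCA ler_wpM2l.
  apply: (@le_trans _ _ (N%:R / n%:R * Qsum q n)).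
    rewrite -mulrA ler_wpM2l// ler_pdivlMl//.
    exact: natM_le_Qsum.
  by rewrite ler_wpM2r// ltW.
(* For alpha = 1 the crude bound q_i <= q_0 <= C0 already gives Q_N = O(N). *)
have [al|al] := ltP alpha 1; last first.
  have -> : alpha = 1 by lra.
  rewrite addr0 powRr1//; apply: ler_wpDr; first by rewrite mulr_ge0.
  rewrite /Qsum mulrC -[N in N%:R](card_ord N) -sumr_const mulr_suml; apply: ler_sum => i _.
  by rewrite mul1r (le_trans _ C00)// qdec.
rewrite mulrDl -addrA; case: N N0 Np Nn {NE Nn1 r r0} N1 => // N _ _ Nn N1.
rewrite /Qsum big_ord_recl; apply: lerD.
  by rewrite (le_trans C00)// ler_peMr.
apply: (@le_trans _ _ (\sum_(i < N) (`|C2| * (4 / (1 - alpha)) * i.+1%:R `^ (alpha - 1) + q n))).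
  apply: ler_sum => i _; rewrite -lerBlDr; apply: seq_diff_le => //=.
  by rewrite /= (leq_trans _ Nn)//= ltnW// ltnS.
rewrite big_split /= sumr_const card_ord; apply: lerD.
  rewrite -mulr_sumr -!mulrA ler_wpM2l// ler_wpM2l// ler_wpM2l ?invr_ge0 ?subr_ge0 ?(ltW al)//.
  apply: le_trans (sum_powR_le _ a01) _; rewrite -mulrA.
  rewrite ler_wpM2l// ler_wpM2l ?invr_ge0 ?(ltW a0)//.
  by apply: ge0_ler_powR; rewrite ?nnegrE ?ler_nat ?(ltnW Nn)// ltW.
by rewrite -[leLHS]mulr_natl ler_wpM2r// ler_nat.
Qed.

End Weights.

Lemma sum_gen_power_powR_le (R : realType) (alpha : R) (m : nat -> nat) (B : nat) K :
  0 < alpha -> (forall n, (2 <= m n <= B)%N) ->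
  \sum_(l < K.+1) (gen_power m l)%:R `^ alpha <=
  (1 - 2 `^ (- alpha))^-1 * (gen_power m K)%:R `^ alpha :> R.
Proof.
move=> a0 hm.
have t1 : 2 `^ (- alpha) < 1 :> R.
  rewrite powRN invf_lt1 ?powR_gt0//.
  by rewrite -[ltLHS](one_powR alpha) gt0_ltr_powR ?nnegrE// ltr1n.
have t0 : 0 < 2 `^ (- alpha) :> R by rewrite powR_gt0.
set t := 2 `^ (- alpha) in t0 t1 *.
have G0 : 0 < (1 - t)^-1 by rewrite invr_gt0 subr_gt0.
elim: K => [|K IH].
  by rewrite big_ord1 ler_peMl ?powR_ge0// invf_ge1 ?subr_gt0// lerBlDr lerDl ltW.
rewrite big_ord_recr /=.
have h : (gen_power m K)%:R `^ alpha <= t * (gen_power m K.+1)%:R `^ alpha :> R.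
  rewrite /t powRN ler_pdivlMl ?powR_gt0// -powRM//.
  apply: ge0_ler_powR; rewrite ?nnegrE ?(ltW a0)//.
  by rewrite -natrM ler_nat (gen_power_double hm).
apply: le_trans (lerD IH (lexx _)) _.
apply: le_trans (lerD (ler_wpM2l (ltW G0) h) (lexx _)) _.
rewrite le_eqVlt; apply/orP; left; apply/eqP; field.
by rewrite subr_eq0 gt_eqF.
Qed.

(** * Averages over finitely many coordinates *)

Section Codes.
Variables (R : realType) (m : nat -> nat) (B : nat).
Hypothesis hm : forall n, (2 <= m n <= B)%N.
Local Notation M := (gen_power m).

(* The points of level [n] of the Vilenkin group are coded by the numbers below
   [M n]; the cylinder of level [l] of a code is its residue modulo [M l]. *)
Definition same_digit (x t : nat) (j : nat) : bool := digit m x j == digit m t j.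

Definition avg (L : nat) (F : nat -> R) : R := (M L)%:R^-1 * \sum_(t < M L) F t.

(** On codes, dependence on the first [l] coordinates only, that is, measurability at time [l]. *)
Definition level (T : Type) (l : nat) (F : nat -> T) := forall x, F x = F (x %% M l)%N.

Lemma gen_power_ne0 n : (M n)%:R != 0 :> R.
Proof. by rewrite pnatr_eq0 -lt0n (gen_power_gt0 hm). Qed.

Lemma gen_power_gt0R n : 0 < (M n)%:R :> R.
Proof. by rewrite ltr0n (gen_power_gt0 hm). Qed.

Lemma base_gt0R n : 0 < (m n)%:R :> R.
Proof. by rewrite ltr0n (base_gt0 hm). Qed.

Lemma sum_gen_powerS (V : nmodType) L (F : nat -> V) :
  \sum_(t < M L.+1) F t = \sum_(a < m L) \sum_(y < M L) F (y + a * M L)%N.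
Proof.
rewrite gen_powerS -(big_mkord xpredT F) big_nat_mul big_mkord; apply: eq_bigr => a _.
rewrite -{1}[(a * M L)%N]add0n big_addn mulSn addnK big_mkord.
by apply: eq_bigr => y _; rewrite addnC.
Qed.

Lemma modn_gen_power l L t : (l <= L)%N -> ((t %% M L) %% M l = t %% M l)%N.
Proof. by move=> lL; rewrite modn_dvdm// dvdn_gen_power. Qed.

Lemma modn_shift l L y a : (l <= L)%N -> ((y + a * M L) %% M l = y %% M l)%N.
Proof.
by move=> lL; have /dvdnP[u ->] := dvdn_gen_power m lL; rewrite mulnA addnC modnMDl.
Qed.

Lemma digit_top L y a : (y < M L)%N -> (a < m L)%N -> digit m (y + a * M L)%N L = a.
Proof.
move=> yM am; rewrite /digit addnC divnMDl ?(gen_power_gt0 hm)//.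
by rewrite [(y %/ _)%N]divn_small// addn0 modn_small.
Qed.

Lemma digit_modn x j l : (j < l)%N -> digit m (x %% M l)%N j = digit m x j.
Proof.
move=> jl; rewrite [in RHS](divn_eq x (M l)) (digit_shift_lt hm)//.
Qed.

Lemma levelW (T : Type) (F : nat -> T) l L : (l <= L)%N -> level l F -> level L F.
Proof.
by move=> lL hF x; rewrite hF [RHS]hF modn_gen_power.
Qed.

Lemma level_add (T : Type) (F : nat -> T) L y a : level L F -> F (y + a * M L)%N = F y.
Proof. by move=> hF; rewrite hF [RHS]hF modn_shift. Qed.

Lemma avgD L F G : avg L (fun t => F t + G t) = avg L F + avg L G.
Proof. by rewrite /avg big_split mulrDr. Qed.

Lemma avgZ L c F : avg L (fun t => c * F t) = c * avg L F.
Proof. by rewrite /avg -mulr_sumr mulrCA. Qed.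

Lemma avg_sum (I : Type) (r : seq I) L (F : I -> nat -> R) :
  avg L (fun t => \sum_(i <- r) F i t) = \sum_(i <- r) avg L (F i).
Proof. by rewrite /avg exchange_big /= mulr_sumr. Qed.

Lemma avg_le L F G : (forall t, F t <= G t) -> avg L F <= avg L G.
Proof. by move=> h; rewrite /avg ler_wpM2l ?invr_ge0// ler_sum. Qed.

Lemma avg_ge0 L F : (forall t, 0 <= F t) -> 0 <= avg L F.
Proof. by move=> h; rewrite /avg mulr_ge0 ?invr_ge0// sumr_ge0. Qed.

Lemma avg_cst L c : avg L (fun=> c) = c.
Proof.
by rewrite /avg sumr_const card_ord -[c *+ _]mulr_natl mulrA mulVf ?mul1r// gen_power_ne0.
Qed.

Lemma avg_levelS L F : level L F -> avg L.+1 F = avg L F.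
Proof.
move=> hF; rewrite /avg sum_gen_powerS.
under eq_bigr => a _ do under eq_bigr => y _ do rewrite level_add//.
rewrite sumr_const card_ord -[_ *+ m L]mulr_natl gen_powerS natrM invfM mulrACA.
by rewrite mulVf ?mul1r// gt_eqF// base_gt0R.
Qed.

Lemma avg_level l L F : (l <= L)%N -> level l F -> avg L F = avg l F.
Proof.
move=> /subnK <- hF; elim: (L - l)%N => [|d IH]//.
by rewrite addSn avg_levelS//; apply: levelW hF; rewrite leq_addl.
Qed.

(** Digit [L] of a uniform code below [M L.+1] is uniform and independent of the lower digits. *)
Lemma avg_same_digit L F x : level L F ->
  avg L.+1 (fun t => (same_digit x t L)%:R * F t) = (m L)%:R^-1 * avg L F.
Proof.
move=> hF; set G := (X in avg L.+1 X).
rewrite /avg (sum_gen_powerS _ G) {}/G gen_powerS natrM invfM -!mulrA.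
congr (_ * (_ * _)).
have dm : (digit m x L < m L)%N by rewrite ltn_mod (base_gt0 hm).
rewrite (bigD1 (Ordinal dm))//= [X in _ + X]big1 ?addr0.
  apply: eq_bigr => y _; rewrite (level_add _ _ hF) /same_digit.
  by rewrite digit_top// eqxx mul1r.
move=> a /eqP aN; rewrite big1// => y _; rewrite /same_digit digit_top//.
by case: eqP => [e|_]; rewrite ?mul0r//; exfalso; apply: aN; apply: val_inj; rewrite /= e.
Qed.

Lemma digit_split x s : (x %% M s.+1 = x %% M s + digit m x s * M s)%N.
Proof.
have xE : x = (x %/ M s %/ m s * (m s * M s) + (x %% M s + digit m x s * M s))%N.
  rewrite {1}(divn_eq x (M s)) {1}(divn_eq (x %/ M s) (m s)) /digit mulnDl -mulnA -addnA.
  by congr addn; rewrite addnC.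
rewrite {1}xE gen_powerS modnMDl modn_small// /digit.
have h1 := ltn_pmod x (gen_power_gt0 hm s); have h2 := ltn_pmod (x %/ M s)%N (base_gt0 hm s).
apply: (@leq_trans (((x %/ M s) %% m s).+1 * M s)); first by rewrite mulSn ltn_add2r.
by rewrite leq_mul2r h2 orbT.
Qed.

Lemma agree_same_digit x t s :
  agree R (same_digit x t) s = (x %% M s == t %% M s)%N%:R.
Proof.
elim: s => [|s IH]; first by rewrite agree0 gen_power0 !modn1.
rewrite agreeS IH -natrM mulnb; congr (nat_of_bool _)%:R.
rewrite !digit_split /same_digit; apply/andP/eqP => [[/eqP -> /eqP ->]//|h].
have e1 : (x %% M s = t %% M s)%N.
  have := congr1 (fun u => u %% M s)%N h; rewrite !modn_shift//.
  by rewrite !modn_mod.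
split; last by apply/eqP.
move: h; rewrite e1 => /addnI/eqP; rewrite eqn_pmul2r ?(gen_power_gt0 hm)//.
Qed.

Lemma same_digit_modn x t j l : (j < l)%N -> same_digit x (t %% M l)%N j = same_digit x t j.
Proof. by move=> jl; rewrite /same_digit digit_modn. Qed.

Lemma agree_eq (d1 d2 : nat -> bool) s :
  (forall j, (j < s)%N -> d1 j = d2 j) -> agree R d1 s = agree R d2 s.
Proof. by move=> h; rewrite /agree; apply: eq_bigr => j _; rewrite h. Qed.

Lemma majorant_eq (d1 d2 : nat -> bool) s :
  (forall j, (j < s)%N -> d1 j = d2 j) -> majorant R m d1 s = majorant R m d2 s.
Proof.
elim: s => //= s IH h; rewrite h// IH; last by move=> j js; rewrite h// ltnW.
by rewrite (@agree_eq d1 d2)// => j js; rewrite h// ltnW.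
Qed.

Lemma level_agree x s : level s (fun t => agree R (same_digit x t) s).
Proof. by move=> t; apply: agree_eq => j js; rewrite same_digit_modn. Qed.

Lemma level_majorant x s : level s (fun t => majorant R m (same_digit x t) s).
Proof. by move=> t; apply: majorant_eq => j js; rewrite same_digit_modn. Qed.

Lemma avg_agree x s : avg s (fun t => agree R (same_digit x t) s) = (M s)%:R^-1.
Proof.
elim: s => [|s IH].
  by under eq_fun do rewrite agree0; rewrite avg_cst gen_power0 invr1.
under eq_fun do rewrite agreeS.
rewrite avg_same_digit; first by rewrite IH gen_powerS natrM invfM.
exact: level_agree.
Qed.

Lemma powR_nat_of_bool (b : bool) (p : R) : p != 0 -> b%:R `^ p = b%:R.
Proof. by case: b => p0; rewrite ?powR0// powR1. Qed.

(** By subadditivity the recursion of [majorant] turns a bound C X, X = M_s^(p-1), into C X / m + X,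
    the division by m coming from the agreement of one more digit. It closes if this is at most C
    m^(p-1) X, i.e. m <= C (m^p - 1), and 2 <= m <= B dictates C = B / (2^p - 1). *)
Lemma avg_majorant_powR x s p : 0 < p <= 1 ->
  avg s (fun t => majorant R m (same_digit x t) s `^ p) <=
  B%:R / (2 `^ p - 1) * (M s)%:R `^ (p - 1).
Proof.
move=> p01; have /andP[p0 p1] := p01; have pN0 : p != 0 by rewrite gt_eqF.
have t2 : 1 < 2 `^ p :> R.
  by rewrite -[ltLHS](one_powR p) gt0_ltr_powR ?nnegrE// ltr1n.
have t22 : 2 `^ p <= 2 :> R by rewrite ler1_powR// ler1n.
have B2 : 2 <= B%:R :> R by rewrite ler_nat (boundB_ge2 hm).
set C := B%:R / _.
have C1 : 1 <= C by rewrite /C ler_pdivlMr ?subr_gt0// mul1r; lra.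
elim: s => [|s IH].
  under eq_fun do rewrite /= one_powR.
  by rewrite avg_cst gen_power0 one_powR mulr1.
apply: (@le_trans _ _ (avg s.+1 (fun t => (same_digit x t s)%:R *
    majorant R m (same_digit x t) s `^ p +
    (M s)%:R `^ p * agree R (same_digit x t) s))).
  apply: avg_le => t /=.
  have ag0 := agree_ge0 R (same_digit x t) s.
  have W0 := majorant_ge0 R m (same_digit x t) s.
  rewrite (le_trans (powR_addr_le _ _ p01)) ?mulr_ge0//.
  by rewrite !powRM// agree_same_digit !powR_nat_of_bool.
rewrite avgD avgZ avg_same_digit; last by move=> t; rewrite level_majorant.
rewrite (@avg_level s s.+1)//; last exact: level_agree.
rewrite avg_agree.
have Ms := gen_power_gt0R s; have ms := base_gt0R s.
rewrite -(powR_subr1E _ Ms) gen_powerS natrM powRM//.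
set X := (M s)%:R `^ (p - 1).
have X0 : 0 <= X by exact: powR_ge0.
apply: (@le_trans _ _ ((m s)%:R^-1 * (C * X) + X)).
  by rewrite lerD2r ler_wpM2l ?invr_ge0.
rewrite (powR_subr1E _ ms).
have h : 1 <= C * ((m s)%:R `^ p - 1) / (m s)%:R.
  rewrite ler_pdivlMr// mul1r.
  apply: (@le_trans _ _ B%:R); first by rewrite ler_nat (base_leB hm).
  rewrite /C mulrAC ler_pdivlMr ?subr_gt0// ler_wpM2l// lerD2r.
  by apply: ge0_ler_powR; rewrite ?nnegrE ?(ltW p0)// ler_nat (base_ge2 hm).
have -> : C * ((m s)%:R `^ p / (m s)%:R * X) =
  (m s)%:R^-1 * (C * X) + C * ((m s)%:R `^ p - 1) / (m s)%:R * X by ring.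
by rewrite lerD2l ler_peMl.
Qed.

(** Up to level [N] the majorant does not see where [t] lies in the cylinder of [c]. Beyond it, the
    new summand contains the agreement of [x] and [t] on at least [N] coordinates, which is
    impossible, so each further level only divides the average by one [m k]. *)
Lemma avg_agree_majorant x c N l : (x %% M N <> c %% M N)%N ->
  avg (maxn N l) (fun t => agree R (same_digit c t) N * majorant R m (same_digit x t) l) =
  majorant R m (same_digit x c) (minn N l) / (M (maxn N l))%:R.
Proof.
move=> xc.
have agxc t k : (N <= k)%N ->
    agree R (same_digit c t) N * agree R (same_digit x t) k = 0.
  move=> /subnK <-; elim: (k - N)%N => [|d IH].
    rewrite add0n !agree_same_digit.
    by case: eqP => [<-|_]; rewrite ?mul0r//; case: eqP => [//|_]; rewrite mulr0.
  by rewrite addSn agreeS mulrCA IH mulr0.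
have small k : (k <= N)%N -> avg N
    (fun t => agree R (same_digit c t) N * majorant R m (same_digit x t) k) =
    majorant R m (same_digit x c) k / (M N)%:R.
  move=> kN; rewrite -(avg_agree c) -avgZ; congr avg; apply/funext => t.
  rewrite agree_same_digit; case: eqP => [ct|_]; last by rewrite mul0r mulr0.
  rewrite mul1r mulr1; apply: majorant_eq => j jk.
  by rewrite -(@same_digit_modn x t j N) -?ct ?same_digit_modn// (leq_trans jk).
have [lN|/ltnW Nl] := leqP l N.
  exact: small.
rewrite -(subnK Nl); elim: (l - N)%N => [|d IH]; first by rewrite small.
rewrite addSn; set k := (d + N)%N in IH *.
under eq_fun => t do
  rewrite /= mulrDr mulrCA [_ * (_ * agree _ _ _)]mulrCA agxc ?leq_addl// mulr0 addr0.
rewrite avg_same_digit; first by rewrite IH gen_powerS natrM invfM; ring.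
move=> t; congr (_ * _); last exact: level_majorant.
by apply: (@levelW _ _ N k) (level_agree c N) _; rewrite leq_addl.
Qed.

End Codes.

(** * Atoms *)

Section Atoms.
Variables (R : realType) (m : nat -> nat) (B : nat).
Hypothesis hm : forall n, (2 <= m n <= B)%N.
Local Notation M := (gen_power m).
Local Notation W x t := (majorant R m (same_digit m x t)).
Local Notation ag x t := (agree R (same_digit m x t)).

Definition pt (c : nat) : vilenkin m := fun k => inZp (digit m c k).

Lemma pt_digit c k : (pt c k : nat) = digit m c k.
Proof.
rewrite /pt /= modn_small// Zp_cast ?(base_ge2 hm)// ltn_mod.
exact: base_gt0 hm k.
Qed.

Lemma pt_eq x t j : (pt x j == pt t j) = same_digit m x t j.
Proof. by rewrite /same_digit -!pt_digit val_eqE. Qed.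

Lemma psi_pt_level k N : (k < M N)%N -> level m N (fun t => psi R k (pt t)).
Proof.
move=> kN t; rewrite !(psi_widen _ hm _ kN); apply: eq_bigr => j _.
by rewrite /rademacher !pt_digit (digit_modn hm).
Qed.

Definition character_kernel x t k : R[i] := psi R k (pt x) * conjc (psi R k (pt t)).

Variables (alpha C0 C1 C2 : R).
Hypothesis a01 : 0 < alpha <= 1.
Variable q : nat -> R.
Hypothesis qdec : nonincreasing_seq q.
Hypothesis q_ge0 : forall n, 0 <= q n.
Hypothesis q0 : 0 < q 0%N.
Hypothesis q0C : q 0%N <= C0.
Hypothesis hQO : forall n, (0 < n)%N -> n%:R `^ alpha / Qsum q n <= C1.
Hypothesis hqO : forall n, (0 < n)%N ->
  (q n - q n.+1) / (n%:R `^ (alpha - 2)) <= C2.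

Definition norlund_kernel n x t : R[i] :=
  \sum_(1 <= k < n.+1) (q (n - k)%N)%:C%C * dirichlet (character_kernel x t) k.

(** The mean as a convolution on the finite group of level [L]; [norlund_meanE] identifies it with
    the mean of a martingale whose [L]-th term is [b], for orders up to [M L]. *)
Definition level_mean L (b : nat -> R[i]) n x : R[i] :=
  (Qsum q n)^-1%:C%C * ((M L)%:R^-1%:C%C * \sum_(t < M L) b t * norlund_kernel n x t).

Definition kernel_const : R := 11 * B%:R ^+ 4 * weight_const alpha C0 C1 C2.

Lemma kernel_const_ge0 : 0 <= kernel_const.
Proof. by rewrite mulr_ge0// (le_trans ler01)// weight_const_ge1. Qed.

Lemma normc_norlund_kernel n K x t : (0 < n <= M K)%N ->
  (Qsum q n)^-1 * nrm (norlund_kernel n x t) <=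
  kernel_const * \sum_(l < K.+1) ((M l)%:R / n%:R) `^ alpha * W x t l.
Proof.
move=> /andP[n0 nK].
have Q0 := Qsum_gt0 q_ge0 q0 n0.
rewrite ler_pdivrMl//.
have h : nrm (norlund_kernel n x t) <=
    11 * B%:R ^+ 4 * \sum_(l < K.+1) Qsum q (minn n (M l)) * W x t l.
  apply: (normc_norlund_kernel_le hm) => //.
  - by move=> k; rewrite /character_kernel Normc.normcM normc_conj !normc_psi mulr1.
  - by rewrite /character_kernel !psi0// rmorph1 mulr1.
  - move=> s c r rM; rewrite /character_kernel !(psi_shift _ hm)// rmorphM /=; ring.
  - move=> s; rewrite -pt_eq; exact: (sum_psi_mul _ hm).
apply: le_trans h _; rewrite /kernel_const [leRHS](_ : _ = 11 * B%:R ^+ 4 *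
  (Qsum q n * weight_const alpha C0 C1 C2 *
   (\sum_(l < K.+1) ((M l)%:R / n%:R) `^ alpha * W x t l))); last by ring.
rewrite ler_wpM2l// mulr_sumr; apply: ler_sum => l _.
rewrite mulrA ler_wpM2r ?majorant_ge0//.
have := Qsum_minn_le a01 qdec q_ge0 q0 q0C hQO hqO n0 (gen_power_gt0 hm l).
by move=> h; apply: le_trans h _; rewrite le_eqVlt; apply/orP; left; apply/eqP; ring.
Qed.

Lemma normc_level_mean_le L b n K x (F : nat -> R) : (0 < n <= M K)%N ->
  (forall t, nrm (b t) <= F t) ->
  nrm (level_mean L b n x) <=
  kernel_const * \sum_(l < K.+1) ((M l)%:R / n%:R) `^ alpha *
    avg m L (fun t => F t * W x t l).
Proof.
move=> nK bF; have /andP[n0 _] := nK.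
have Q0 := Qsum_gt0 q_ge0 q0 n0.
rewrite /level_mean !Normc.normcM !normc_real ?invr_ge0// ?(ltW Q0)//.
apply: (@le_trans _ _ (avg m L (fun t => F t * ((Qsum q n)^-1 * nrm (norlund_kernel n x t))))).
  rewrite /avg mulrCA ler_wpM2l ?invr_ge0//.
  rewrite ler_pdivrMl// mulr_sumr; apply: le_trans (normc_sum _ _ _) _.
  apply: ler_sum => t _; rewrite Normc.normcM mulrCA mulVKf ?gt_eqF//.
  by rewrite ler_wpM2r ?normc_ge0.
rewrite [leRHS](_ : _ = avg m L (fun t => kernel_const *
    \sum_(l < K.+1) ((M l)%:R / n%:R) `^ alpha * (F t * W x t l))); last first.
  rewrite avgZ (avg_sum m (index_enum _) L
    (fun (l : 'I_K.+1) t => ((M l)%:R / n%:R) `^ alpha * (F t * W x t l))).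
  by congr (_ * _); apply: eq_bigr => l _; rewrite avgZ.
apply: avg_le => t.
have F0 : 0 <= F t by apply: le_trans (bF t); exact: normc_ge0.
apply: le_trans (ler_wpM2l F0 (normc_norlund_kernel x t nK)) _.
rewrite mulrCA mulr_sumr le_eqVlt; apply/orP; left; apply/eqP.
by congr (_ * _); apply: eq_bigr => l _; ring.
Qed.

Local Notation G := ((1 - 2 `^ (- alpha))^-1 : R).

Let a0 : 0 < alpha. Proof. by case/andP: a01. Qed.
Let a1 : alpha <= 1. Proof. by case/andP: a01. Qed.

Lemma geometric_const_gt0 : 0 < G.
Proof.
rewrite invr_gt0 subr_gt0 powRN invf_lt1 ?powR_gt0//.
by rewrite -[ltLHS](one_powR alpha) gt0_ltr_powR ?nnegrE// ltr1n.
Qed.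

(** The least [K] is taken so that [M K] is comparable with [n]; this bounds the geometric sums of
    (M_l / n)^alpha. *)
Lemma exists_gen_power_between n L : (0 < n <= M L)%N ->
  exists K, [/\ (K <= L)%N, (n <= M K)%N, (M K <= B * n)%N &
    forall N, (M N <= n)%N -> (N <= K)%N].
Proof.
move=> /andP[n0 nL].
have exK : exists K, (n <= M K)%N by exists L.
case: (ex_minnP exK) => K nK Kmin; exists K; split => //; first exact: Kmin.
  case: K nK Kmin => [|K] nK Kmin.
    by rewrite gen_power0; have := boundB_ge2 hm; nia.
  have Kn : (M K < n)%N by rewrite ltnNge; apply/negP => /Kmin; rewrite ltnn.
  by have := gen_powerS_leB hm K; nia.
by move=> N Nn; rewrite -(leq_gen_power hm) (leq_trans Nn).
Qed.

Lemma sum_ratio_powR_le n K : (0 < n)%N -> (M K <= B * n)%N ->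
  \sum_(l < K.+1) ((M l)%:R / n%:R) `^ alpha <= G * B%:R :> R.
Proof.
move=> n0 Kn; have n0R : 0 < n%:R :> R by rewrite ltr0n.
under eq_bigr do rewrite powRM ?invr_ge0//.
rewrite -mulr_suml.
apply: (@le_trans _ _ (G * (M K)%:R `^ alpha * n%:R^-1 `^ alpha)).
  by rewrite ler_wpM2r ?powR_ge0// (sum_gen_power_powR_le _ a0 hm).
rewrite -mulrA ler_wpM2l ?(ltW geometric_const_gt0)// -powRM ?invr_ge0//.
have MB : (M K)%:R / n%:R <= B%:R :> R by rewrite ler_pdivrMr// -natrM ler_nat.
apply: (@le_trans _ _ (B%:R `^ alpha)).
  by apply: ge0_ler_powR; rewrite ?nnegrE ?divr_ge0// ltW.
by rewrite ler1_powR// ler1n; apply: leq_trans (boundB_ge2 hm).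
Qed.

(* Divided by [M N], bounds the means of an atom living on the cylinder of [c]
   at the points [x] outside this cylinder. *)
Definition tail_sum N c x : R :=
  \sum_(l < N.+1) ((M l)%:R / (M N)%:R) `^ alpha * W x c l.

Lemma tail_sum_ge0 N c x : 0 <= tail_sum N c x.
Proof. by apply: sumr_ge0 => l _; rewrite mulr_ge0 ?powR_ge0 ?majorant_ge0. Qed.

Lemma majorant_le_tail_sum N c x : W x c N <= tail_sum N c x.
Proof.
rewrite /tail_sum big_ord_recr /= divff ?(gen_power_ne0 _ hm)// one_powR mul1r.
by rewrite lerDr sumr_ge0// => l _; rewrite mulr_ge0 ?powR_ge0 ?majorant_ge0.
Qed.

Definition atom_const : R := kernel_const * ((1 + G * B%:R) * B%:R).

Lemma atom_const_ge0 : 0 <= atom_const.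
Proof.
rewrite /atom_const mulr_ge0 ?kernel_const_ge0// mulr_ge0// addr_ge0// mulr_ge0//.
exact: ltW geometric_const_gt0.
Qed.

Let B1 : 1 <= B%:R :> R.
Proof. by rewrite ler1n; apply: leq_trans (boundB_ge2 hm). Qed.

(** Uniform integrability in mean of the kernels: the case p = 1 of [avg_majorant_powR] bounds every
    averaged majorant by [B]. *)
Lemma sum_avg_near n K L x : (K <= L)%N -> (0 < n)%N -> (M K <= B * n)%N ->
  \sum_(l < K.+1) ((M l)%:R / n%:R) `^ alpha * avg m L (fun t => W x t l) <=
  (1 + G * B%:R) * B%:R.
Proof.
move=> KL n0 Kn.
have avgW l : (l <= L)%N -> avg m L (fun t => W x t l) <= B%:R.
  move=> lL; rewrite (avg_level hm lL); last exact: (level_majorant _ hm).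
  have p11 : 0 < (1 : R) <= 1 by rewrite ltr01 lexx.
  have := avg_majorant_powR hm x l p11.
  rewrite powRr1// subrr powRr0 mulr1 (_ : 2 - 1 = 1 :> R) ?divr1; last by ring.
  by apply: le_trans; apply: avg_le => t; rewrite powRr1// majorant_ge0.
apply: (@le_trans _ _ (\sum_(l < K.+1) ((M l)%:R / n%:R) `^ alpha * B%:R)).
  apply: ler_sum => l _; rewrite ler_wpM2l ?powR_ge0// avgW//.
  by rewrite (leq_trans _ KL)// -ltnS.
rewrite -mulr_suml ler_wpM2r//; apply: le_trans (sum_ratio_powR_le n0 Kn) _.
by rewrite lerDr.
Qed.

(** For l <= N the ratio grows when [n] is lowered to [M N], giving [tail_sum]. For l > N the
    majorant stays frozen at level [N] and the remaining geometric sum is bounded, so these levels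
    cost a multiple of the last term of [tail_sum]. *)
Lemma sum_avg_far n K L N c x : (K <= L)%N -> (0 < n)%N -> (M K <= B * n)%N ->
  (M N <= n)%N -> (N <= K)%N -> (x %% M N <> c %% M N)%N ->
  \sum_(l < K.+1) ((M l)%:R / n%:R) `^ alpha *
     avg m L (fun t => ag c t N * W x t l) <=
  (1 + G * B%:R) * (tail_sum N c x / (M N)%:R).
Proof.
move=> KL n0 Kn Nn NK xc.
have n0R : 0 < n%:R :> R by rewrite ltr0n.
have MN0 : 0 < (M N)%:R :> R := gen_power_gt0R _ hm N.
have W0 l := majorant_ge0 R m (same_digit m x c) l.
have avgE l : (l <= K)%N -> avg m L (fun t => ag c t N * W x t l) <=
    W x c (minn N l) / (M N)%:R.
  move=> lK; rewrite (@avg_level _ _ _ hm (maxn N l)); first last.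
  - move=> t; congr (_ * _).
      exact: (levelW (leq_maxl N l) (level_agree R hm c N) t).
    exact: (levelW (leq_maxr N l) (level_majorant R hm x l) t).
  - by rewrite geq_max (leq_trans NK)// (leq_trans lK).
  rewrite (avg_agree_majorant _ hm)// ler_wpM2l// lef_pV2 ?posrE ?(gen_power_gt0R _ hm)//.
  by rewrite ler_nat (leq_gen_power hm) leq_maxl.
apply: (@le_trans _ _ (\sum_(l < K.+1)
   (((if (l < N.+1)%N then ((M l)%:R / (M N)%:R) `^ alpha * W x c l else 0)
   + ((M l)%:R / n%:R) `^ alpha * W x c N) / (M N)%:R))).
  apply: ler_sum => l _.
  have lK : (l <= K)%N by rewrite -ltnS.
  apply: le_trans (ler_wpM2l (powR_ge0 _ _) (avgE l lK)) _.
  rewrite mulrA ler_wpM2r ?invr_ge0// ltnS; have [lN|Nl] := leqP l N.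
    rewrite -[leLHS]addr0; apply: lerD; last by rewrite mulr_ge0 ?powR_ge0.
    rewrite ler_wpM2r//; apply: ge0_ler_powR; rewrite ?nnegrE ?divr_ge0 ?(ltW a0)//.
    by rewrite ler_wpM2l// lef_pV2 ?posrE// ler_nat.
  by rewrite add0r.
rewrite -mulr_suml mulrA ler_wpM2r ?invr_ge0// big_split /= mulrDl mul1r; apply: lerD.
  rewrite /tail_sum (big_ord_widen K.+1 (fun l => ((M l)%:R / (M N)%:R) `^ alpha * W x c l))//.
  by rewrite [leRHS]big_mkcond.
rewrite -mulr_suml; apply: ler_pM => //.
- by apply: sumr_ge0 => l _; exact: powR_ge0.
- exact: sum_ratio_powR_le.
- exact: majorant_le_tail_sum.
Qed.

(** Characters of order below [M N] only see the first [N] coordinates, so the kernel is constant in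
    [t] on the support of [b] and factors out of a vanishing sum. *)
Lemma level_mean_eq0 L b N c n x : (N <= L)%N ->
  (forall t, b t != 0 -> (t %% M N = c %% M N)%N) ->
  \sum_(t < M L) b t = 0 -> (n <= M N)%N -> level_mean L b n x = 0.
Proof.
move=> NL supp b0 nN; rewrite /level_mean.
have -> : \sum_(t < M L) b t * norlund_kernel n x t =
    \sum_(t < M L) b t * norlund_kernel n x c.
  apply: eq_bigr => t _; have [->|bt] := eqVneq (b t) 0; first by rewrite !mul0r.
  congr (_ * _); rewrite /norlund_kernel; apply: eq_big_nat => k /andP[_ kn].
  congr (_ * _); apply: eq_bigr => j _; rewrite /character_kernel.
  have jN : (j < M N)%N by have := ltn_ord j; lia.
  by rewrite (psi_pt_level jN t) (supp t bt) -(psi_pt_level jN c).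
by rewrite -mulr_suml b0 mul0r !mulr0.
Qed.

Lemma atom_mean_bound L b N c lam n x : (N <= L)%N -> 0 <= lam ->
  (forall t, nrm (b t) <= lam * ag c t N) ->
  (N = 0)%N \/ \sum_(t < M L) b t = 0 -> (0 < n <= M L)%N ->
  nrm (level_mean L b n x) <=
  lam * atom_const * (ag x c N + tail_sum N c x / (M N)%:R) *+ (M N <= n)%N.
Proof.
move=> NL lam0 bB bN nL; have /andP[n0 _] := nL.
have T0 := tail_sum_ge0 N c x.
have [Nn|nN] := leqP (M N) n; last first.
  (* At N = 0 the mean value may be nonzero, but no positive order is below M 0 = 1. *)
  case: bN => [N0|b0]; first by move: nN; rewrite N0 gen_power0; lia.
  rewrite (@level_mean_eq0 L b N c n x NL _ b0 (ltnW nN)) ?Normc.normc0// => t bt.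
  apply/eqP; rewrite eq_sym -[_ == _]negbK; apply/negP => /negPf ct.
  have := bB t; rewrite (agree_same_digit _ hm) ct mulr0 => nb.
  case/eqP: bt; apply: Normc.eq0_normc; apply/eqP.
  by rewrite eq_le nb normc_ge0.
have [K [KL nK Kn KN]] := exists_gen_power_between nL.
have nK' : (0 < n <= M K)%N by rewrite n0.
apply: le_trans (normc_level_mean_le L x nK' bB) _.
have -> : \sum_(l < K.+1) ((M l)%:R / n%:R) `^ alpha *
    avg m L (fun t => lam * ag c t N * W x t l) =
  lam * \sum_(l < K.+1) ((M l)%:R / n%:R) `^ alpha * avg m L (fun t => ag c t N * W x t l).
  rewrite mulr_sumr; apply: eq_bigr => l _; rewrite [RHS]mulrCA -(avgZ m L lam).
  by congr (_ * _); congr avg; apply/funext => t; rewrite mulrA.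
rewrite mulr1n [leLHS]mulrCA -[leRHS]mulrA ler_wpM2l// /atom_const.
rewrite -[leRHS]mulrA ler_wpM2l ?kernel_const_ge0//.
have GB : 0 <= 1 + G * B%:R.
  by rewrite addr_ge0// mulr_ge0// ltW// geometric_const_gt0.
rewrite (agree_same_digit _ hm); have [xc|/eqP xc] := eqVneq (x %% M N)%N (c %% M N)%N.
  apply: (@le_trans _ _ ((1 + G * B%:R) * B%:R)); last first.
    by rewrite ler_peMr ?mulr_ge0// lerDl divr_ge0.
  apply: le_trans (sum_avg_near x KL n0 Kn); apply: ler_sum => l _.
  rewrite ler_wpM2l ?powR_ge0//; apply: avg_le => t.
  rewrite ler_piMl ?majorant_ge0// (agree_same_digit _ hm).
  by case: eqP.
rewrite add0r; apply: le_trans (sum_avg_far KL n0 Kn Nn (KN N Nn) xc) _.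
by rewrite -mulrA ler_wpM2l// ler_peMl// divr_ge0.
Qed.

Local Notation p := ((1 + alpha)^-1 : R).

Lemma Hardy_exponent_bounds : 0 < p <= 1.
Proof. by rewrite invr_gt0 invf_le1; have := a0; lra. Qed.

Let p01 := Hardy_exponent_bounds.
Let p0 : 0 < p. Proof. by case/andP: p01. Qed.
Let pN0 : p != 0. Proof. by rewrite gt_eqF. Qed.

Lemma Hardy_exponentE : alpha * p = 1 - p.
Proof. by field; have := a0; lra. Qed.

(** Free of [n], hence a bound for the whole supremum. Only the tail gains the factor 1/(N+1) from
    the logarithm; on the cylinder itself the weight merely has to stay away from 0. *)
Definition atom_majorant lam N c x : R :=
  (lam * atom_const) `^ p * (2 / ln 2) *
  (ag x c N + (tail_sum N c x / (M N)%:R) `^ p / N.+1%:R).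

Let ln2 : 0 < ln 2 :> R. Proof. by rewrite ln_gt0// ltr1n. Qed.

Lemma atom_majorant_ge0 lam N c x : 0 <= atom_majorant lam N c x.
Proof.
apply: mulr_ge0; first by rewrite mulr_ge0 ?powR_ge0// divr_ge0// ltW.
by rewrite addr_ge0 ?agree_ge0// divr_ge0 ?powR_ge0.
Qed.

(** 2^N <= M_N <= n pays for [N] copies of ln 2, and n >= 1 for one more. *)
Lemma ln_ge_level N n : (0 < n)%N -> (M N <= n)%N ->
  N.+1%:R * ln 2 <= 2 * ln n.+1%:R :> R.
Proof.
move=> n0 Nn.
have h1 : ln 2 <= ln n.+1%:R :> R by rewrite ler_ln ?posrE ?ltr0n// ler_nat.
have h2 : N%:R * ln 2 <= ln n.+1%:R :> R.
  rewrite mulr_natl -lnXn// ler_ln ?posrE ?ltr0n ?exprn_gt0// -natrX ler_nat.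
  by rewrite (leq_trans (gen_power_expn hm N))// (leq_trans Nn).
by rewrite -natr1; lra.
Qed.

Lemma atom_mean_powR_bound L b N c lam n x : (N <= L)%N -> 0 <= lam ->
  (forall t, nrm (b t) <= lam * ag c t N) ->
  (N = 0)%N \/ \sum_(t < M L) b t = 0 -> (0 < n <= M L)%N ->
  nrm (level_mean L b n x) `^ p / ln n.+1%:R <= atom_majorant lam N c x.
Proof.
move=> NL lam0 bB bN nL; have /andP[n0 _] := nL.
have T0 := tail_sum_ge0 N c x.
have lC0 : 0 <= lam * atom_const by rewrite mulr_ge0// atom_const_ge0.
have h := atom_mean_bound x NL lam0 bB bN nL.
have [Nn|nN] := leqP (M N) n; last first.
  move: h; rewrite leqNgt nN mulr0n => h.
  have -> : nrm (level_mean L b n x) = 0 by apply/eqP; rewrite eq_le h normc_ge0.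
  by rewrite powR0// mul0r atom_majorant_ge0.
rewrite Nn mulr1n in h.
have lnn0 : 0 < ln n.+1%:R :> R by rewrite ln_gt0// ltr1n.
rewrite ler_pdivrMr//.
have ag0 := agree_ge0 R (same_digit m x c) N.
have hp : nrm (level_mean L b n x) `^ p <=
    (lam * atom_const) `^ p * (ag x c N + (tail_sum N c x / (M N)%:R) `^ p).
  apply: (@le_trans _ _ ((lam * atom_const * (ag x c N + tail_sum N c x / (M N)%:R)) `^ p)).
    by apply: ge0_ler_powR; rewrite ?nnegrE ?normc_ge0 ?(ltW p0)// mulr_ge0// addr_ge0// divr_ge0.
  rewrite [leLHS]powRM//; last by rewrite addr_ge0// divr_ge0.
  rewrite ler_wpM2l ?powR_ge0//.
  apply: le_trans (powR_addr_le ag0 _ p01) _; first by rewrite divr_ge0.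
  by rewrite (agree_same_digit _ hm) powR_nat_of_bool.
apply: le_trans hp _; rewrite /atom_majorant -!mulrA ler_wpM2l ?powR_ge0//.
set P := _ `^ p; have P0 : 0 <= P by exact: powR_ge0.
have hl := ln_ge_level n0 Nn.
have k1 : 1 <= 2 * (ln 2)^-1 * ln n.+1%:R / N.+1%:R :> R.
  by rewrite ler_pdivlMr// mul1r mulrAC ler_pdivlMr.
have N1 : N.+1%:R^-1 <= 1 :> R by rewrite invf_le1// ler1n.
have k2 : 1 <= 2 * (ln 2)^-1 * ln n.+1%:R :> R.
  apply: le_trans k1 _; rewrite ler_piMr// mulr_ge0 ?(ltW lnn0)// mulr_ge0// invr_ge0 ltW//.
have -> : 2 * ((ln 2)^-1 * ((ag x c N + P / N.+1%:R) * ln n.+1%:R)) =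
  (2 * (ln 2)^-1 * ln n.+1%:R) * ag x c N + (2 * (ln 2)^-1 * ln n.+1%:R / N.+1%:R) * P by ring.
by apply: lerD; rewrite ler_peMl.
Qed.

Lemma same_digit_sym x t : same_digit m x t = same_digit m t x.
Proof. by apply/funext => j; rewrite /same_digit eq_sym. Qed.

Definition avg_atom_const : R :=
  atom_const `^ p * (2 / ln 2) * (1 + B%:R / (2 `^ p - 1)).

(** The p-th power of W_l has average O(M_l^(p-1)) and carries the weight (M_l / M_N)^(alpha p). As
    alpha p = 1 - p, every level l <= N contributes the same O(M_N^(p-1)); the N+1 equal terms
    cancel 1/(N+1), and the normalization M_N^(-p) leaves 1/M_N, the measure of the cylinder. *)
Lemma avg_atom_majorant lam N c L : (N <= L)%N -> 0 <= lam ->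
  avg m L (atom_majorant lam N c) <= avg_atom_const * (lam `^ p / (M N)%:R).
Proof.
move=> NL lam0; rewrite /atom_majorant avgZ powRM ?atom_const_ge0//.
have MN0 : 0 < (M N)%:R :> R := gen_power_gt0R _ hm N.
have K0 : 0 <= atom_const `^ p * (2 / ln 2).
  by rewrite mulr_ge0 ?powR_ge0// divr_ge0// ltW.
rewrite (_ : lam `^ p * _ * _ = lam `^ p * (atom_const `^ p * (2 / ln 2))); last by ring.
rewrite /avg_atom_const [leRHS](_ : _ = lam `^ p * (atom_const `^ p * (2 / ln 2)) *
   ((1 + B%:R / (2 `^ p - 1)) / (M N)%:R)); last by ring.
rewrite ler_wpM2l//; first by rewrite mulr_ge0 ?powR_ge0.
rewrite avgD [leRHS]mulrDl mul1r; apply: lerD.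
  under eq_fun => x do rewrite same_digit_sym.
  by rewrite (avg_level hm NL (level_agree _ hm c N)) (avg_agree _ hm).
set C := B%:R / _.
apply: (@le_trans _ _ (avg m L (fun x => (M N)%:R `^ (- p) / N.+1%:R *
    \sum_(l < N.+1) ((M l)%:R / (M N)%:R) `^ (1 - p) * majorant R m (same_digit m c x) l `^ p))).
  apply: avg_le => x; rewrite powRM ?tail_sum_ge0 ?invr_ge0//.
  rewrite -[(M N)%:R^-1 `^ p](_ : (M N)%:R `^ (- p) = _); last first.
    by rewrite -[in RHS]powR_inv1// -powRrM mulN1r.
  rewrite -mulrA mulrC ler_wpM2l ?divr_ge0 ?powR_ge0//.
  apply: le_trans (powR_sum_le _ p01 _) _.
    by move=> l _; rewrite mulr_ge0 ?powR_ge0 ?majorant_ge0.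
  apply: ler_sum => l _; rewrite powRM ?powR_ge0 ?majorant_ge0//.
  by rewrite -powRrM Hardy_exponentE same_digit_sym.
rewrite avgZ (avg_sum m (index_enum _) L (fun (l : 'I_N.+1) x => _)).
apply: (@le_trans _ _ ((M N)%:R `^ (- p) / N.+1%:R * \sum_(l < N.+1) (C * (M N)%:R `^ (p - 1)))).
  rewrite ler_wpM2l ?divr_ge0 ?powR_ge0//; apply: ler_sum => l _.
  have lL : (l <= L)%N by rewrite (leq_trans _ NL)// -ltnS.
  rewrite avgZ (avg_level hm lL); last first.
    by move=> t /=; rewrite -(level_majorant R hm c l t).
  apply: le_trans (ler_wpM2l (powR_ge0 _ _) (avg_majorant_powR hm c l p01)) _.
  have Ml0 : 0 < (M l)%:R :> R := gen_power_gt0R _ hm l.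
  rewrite -/C mulrCA ler_wpM2l//.
    rewrite divr_ge0// subr_ge0 -[leLHS](one_powR p).
    by apply: ge0_ler_powR; rewrite ?nnegrE ?(ltW p0)// ler1n.
  have -> : ((M l)%:R / (M N)%:R) `^ (1 - p) = (M l)%:R `^ (1 - p) * (M N)%:R `^ (p - 1).
    rewrite powRM ?invr_ge0//; congr (_ * _).
    by rewrite -(powR_inv1 (ltW MN0)) -powRrM; congr (_ `^ _); ring.
  rewrite mulrAC -powRD; last by apply/implyP => _; rewrite gt_eqF.
  by rewrite (_ : 1 - p + (p - 1) = 0) ?powRr0 ?mul1r//; ring.
rewrite sumr_const card_ord -[(C * _) *+ _]mulr_natl.
have -> : (M N)%:R `^ (- p) / N.+1%:R * (N.+1%:R * (C * (M N)%:R `^ (p - 1))) =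
  C * ((M N)%:R `^ (- p) * (M N)%:R `^ (p - 1)).
  by rewrite [LHS]mulrA divfK ?pnatr_eq0// mulrCA.
rewrite -powRD; last by apply/implyP => _; rewrite gt_eqF.
by rewrite addrA addNr add0r powR_inv1.
Qed.

End Atoms.

(** * Atomic decomposition of finite martingales *)

Section PredictableMajorant.
Variables (R : realType) (m : nat -> nat) (B : nat).
Hypothesis hm : forall n, (2 <= m n <= B)%N.
Local Notation M := (gen_power m).
Variable phi : nat -> nat -> R.
Hypothesis phi_level : forall n, level m n (phi n).
Hypothesis phi_mono : forall n x, phi n x <= phi n.+1 x.
Hypothesis phi_ge0 : forall n x, 0 <= phi n x.

(* The compensator of [phi] blown up by the number of children, hence above
   [phi n.+1] while depending only on the first [n] coordinates. *)
Definition predictable n x : R :=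
  phi 0 x + \sum_(j < n.+1) \sum_(a < m j) (phi j.+1 (x %% M j + a * M j)%N - phi j x).

Lemma phi_child_ge j x (a : nat) : phi j x <= phi j.+1 (x %% M j + a * M j)%N.
Proof.
apply: le_trans (phi_mono j _).
by rewrite [leRHS]phi_level modn_shift// modn_mod -phi_level.
Qed.

Lemma predictable_level n : level m n (predictable n).
Proof.
move=> x; rewrite /predictable; congr (_ + _).
  by apply: (levelW (leq0n n)) (phi_level 0) x.
apply: eq_bigr => j _; apply: eq_bigr => a _; have jn : (j <= n)%N by rewrite -ltnS.
by rewrite modn_gen_power//; congr (_ - _); apply: (levelW jn (phi_level j)).
Qed.

Lemma predictable_mono n x : predictable n x <= predictable n.+1 x.
Proof.
rewrite /predictable [in leRHS]big_ord_recr /= addrA lerDl.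
by apply: sumr_ge0 => a _; rewrite subr_ge0 phi_child_ge.
Qed.

(** Telescoping [phi] along the path of [x], each actual increment is one of the nonnegative
    increments summed over all children. *)
Lemma phi_le_predictable n x : phi n.+1 x <= predictable n x.
Proof.
rewrite /predictable -[leLHS](subrK (phi 0 x)) addrC lerD2l.
rewrite -(telescope_sumr (fun j => phi j x))// big_mkord; apply: ler_sum => j _.
have dm : (digit m x j < m j)%N by rewrite ltn_mod (base_gt0 hm).
rewrite (bigD1 (Ordinal dm))//= -(digit_split hm)// -phi_level lerDl.
by apply: sumr_ge0 => a _; rewrite subr_ge0 phi_child_ge.
Qed.

(** On average the sum over the children of a node is [m j] times the mean increment; bounding [m j]
    by [B] lets the mean increments telescope. *)
Lemma avg_predictable n : avg m n.+1 (predictable n) <= B%:R * avg m n.+1 (phi n.+1).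
Proof.
have B1 : 1 <= B%:R :> R by rewrite ler1n; apply: leq_trans (boundB_ge2 hm).
have step j : avg m j (fun x => \sum_(a < m j) (phi j.+1 (x %% M j + a * M j)%N - phi j x)) =
    (m j)%:R * (avg m j.+1 (phi j.+1) - avg m j (phi j)).
  rewrite /avg; have -> : \sum_(t < M j.+1) phi j.+1 t =
      \sum_(t < M j) \sum_(a < m j) phi j.+1 (t %% M j + a * M j)%N.
    rewrite sum_gen_powerS exchange_big /=; apply: eq_bigr => y _.
    by apply: eq_bigr => a _; rewrite modn_small.
  under eq_bigr do rewrite sumrB sumr_const card_ord -[phi j _ *+ _]mulr_natl.
  rewrite sumrB -mulr_sumr gen_powerS natrM; field.
  by rewrite (gen_power_ne0 R hm) gt_eqF// (base_gt0R R hm).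
have avgS j : avg m j (phi j) <= avg m j.+1 (phi j.+1).
  by rewrite -(avg_levelS hm (phi_level j)); apply: avg_le => x; exact: phi_mono.
rewrite /predictable avgD (avg_sum m (index_enum _) n.+1 (fun (j : 'I_n.+1) x => _)).
rewrite (avg_level hm (leq0n _) (phi_level 0)).
have -> : \sum_(j < n.+1) avg m n.+1
    (fun x => \sum_(a < m j) (phi j.+1 (x %% M j + a * M j)%N - phi j x)) =
  \sum_(j < n.+1) (m j)%:R * (avg m j.+1 (phi j.+1) - avg m j (phi j)).
  apply: eq_bigr => j _; rewrite -step (avg_level hm (ltnW (ltn_ord j)))// => x.
  by apply: eq_bigr => a _; rewrite modn_mod -phi_level.
apply: (@le_trans _ _ (avg m 0 (phi 0) +
    B%:R * (avg m n.+1 (phi n.+1) - avg m 0 (phi 0)))).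
  rewrite lerD2l -(telescope_sumr (fun j => avg m j (phi j)))// big_mkord mulr_sumr.
  by apply: ler_sum => j _; rewrite ler_wpM2r ?subr_ge0// ler_nat (base_leB hm).
rewrite mulrBr addrCA gerDl subr_le0 ler_peMl//.
by apply: avg_ge0 => x; exact: phi_ge0.
Qed.

End PredictableMajorant.

Section DyadicIndex.
Variable R : realType.

Lemma dyadic_exists (eps v : R) : 0 < eps -> exists k, v <= eps * 2 ^+ k.
Proof.
move=> e0; exists (Num.bound (v / eps)).
by rewrite -ler_pdivrMl// mulrC ltW// upper_nthrootP.
Qed.

(** The floor [eps] keeps the index a natural number even where [v] vanishes; its price is the
    additive [eps] in [dyadic_index_le]. *)
Definition dyadic_index (eps : R) (e0 : 0 < eps) (v : R) : nat :=
  ex_minn (dyadic_exists v e0).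

Variables (eps : R) (e0 : 0 < eps).
Local Notation idx := (dyadic_index e0).

Lemma le_dyadic_index v : v <= eps * 2 ^+ idx v.
Proof. by rewrite /dyadic_index; case: ex_minnP. Qed.

Lemma dyadic_index_mono v w : v <= w -> (idx v <= idx w)%N.
Proof.
move=> vw; rewrite {1}/dyadic_index; case: ex_minnP => k _; apply.
exact: le_trans vw (le_dyadic_index w).
Qed.

Lemma dyadic_index_le v : 0 <= v -> eps * 2 ^+ idx v <= eps + 2 * v.
Proof.
move=> v0; rewrite /dyadic_index; case: ex_minnP => -[|k] hk kmin.
  by rewrite expr0 mulr1 lerDl mulr_ge0.
have : eps * 2 ^+ k < v by rewrite ltNge; apply/negP => /kmin; rewrite ltnn.
by rewrite exprS; have := e0; lra.
Qed.

End DyadicIndex.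

(** * Cutting a martingale at the jumps of a height *)

Section AtomicDecomposition.
Variables (R : realType) (m : nat -> nat) (B : nat).
Hypothesis hm : forall n, (2 <= m n <= B)%N.
Local Notation M := (gen_power m).

Lemma sum_level (V : nmodType) l L (F : nat -> V) : (l <= L)%N -> level m l F ->
  \sum_(t < M L) F t = (\sum_(t < M l) F t) *+ (M L %/ M l).
Proof.
move=> /subnK <- hF; elim: (L - l)%N => [|d IH].
  by rewrite add0n divnn (gen_power_gt0 hm) mulr1n.
rewrite addSn sum_gen_powerS.
under eq_bigr => a _ do under eq_bigr => y _ do
  rewrite (level_add _ _ (levelW (leq_addl d l) hF)).
rewrite sumr_const card_ord IH -mulrnA gen_powerS; congr (_ *+ _).
by rewrite [LHS]mulnC muln_divA// dvdn_gen_power// leq_addl.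
Qed.

Variable f : nat -> nat -> R[i].
Hypothesis f_level : forall n, level m n (f n).
Hypothesis f_mart : forall n y, (y < M n)%N ->
  \sum_(a < m n) f n.+1 (y + a * M n)%N = f n y *+ m n.

Definition mart_diff j t : R[i] := f j.+1 t - f j t.

Lemma sum_mart_diff L j (g : nat -> R[i]) : (j < L)%N -> level m j g ->
  \sum_(t < M L) g t * mart_diff j t = 0.
Proof.
move=> jL hg; pose F t := g t * mart_diff j t.
rewrite -/(F _) (sum_level (F := F) jL); last first.
  move=> t; rewrite /F; congr (_ * (_ - _)); first exact: (levelW (leqnSn j) hg).
    exact: f_level.
  exact: (levelW (leqnSn j) (f_level j)).
rewrite sum_gen_powerS exchange_big /= big1 ?mul0rn// => y _; rewrite /F.
have e : \sum_(a < m j) (f j.+1 (y + a * M j)%N - f j y) = 0.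
  by rewrite sumrB f_mart// sumr_const card_ord subrr.
transitivity (g y * \sum_(a < m j) (f j.+1 (y + a * M j)%N - f j y)).
  rewrite mulr_sumr; apply: eq_bigr => a _; rewrite /mart_diff (level_add _ _ hg).
  by rewrite (level_add _ _ (f_level j)).
by rewrite e mulr0.
Qed.

Variable kap : nat -> nat -> nat.
Hypothesis kap_level : forall n, level m n (kap n).
Hypothesis kap_mono : forall n x, (kap n x <= kap n.+1 x)%N.

Lemma kap_homo i j x : (i <= j)%N -> (kap i x <= kap j x)%N.
Proof.
by move=> /subnK <-; elim: (j - i)%N => // d IH; rewrite addSn (leq_trans IH).
Qed.

(* [kap] is a discretized height of the martingale: a level is new when the
   height jumps there, and the piece started at a new level collects the
   increments up to the next jump. *)
Definition new_level N t : bool := if N is N'.+1 then (kap N' t < kap N t)%N else true.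

Definition piece L N t : R[i] := (new_level N t)%:R *
  ((N == 0%N)%:R * f 0 t + \sum_(j < L) ((N <= j)%N && (kap j t == kap N t))%:R * mart_diff j t).

(** The unique such [N] is the time of the last jump up to [j], or 0 if there is none; hence every
    increment belongs to exactly one piece. *)
Lemma sum_new_level j L t : (j < L)%N ->
  (\sum_(N < L) nat_of_bool (new_level N t && ((N <= j) && (kap j t == kap N t))) = 1)%N.
Proof.
move=> jL.
have -> : (\sum_(N < L) nat_of_bool (new_level N t && ((N <= j) && (kap j t == kap N t))) =
   \sum_(N < j.+1) nat_of_bool (new_level N t && (kap j t == kap N t)))%N.
  rewrite (big_ord_widen L (fun N => nat_of_bool (new_level N t && (kap j t == kap N t))))//.
  rewrite big_mkcond [RHS]big_mkcond; apply: eq_bigr => N _ /=.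
  by rewrite ltnS; case: leqP; rewrite //= andbF.
elim: j {jL} => [|j IH]; first by rewrite big_ord1 /= eqxx.
rewrite big_ord_recr /= eqxx andbT.
have := kap_mono j t; rewrite leq_eqVlt => /orP[/eqP e|lt].
  by rewrite -e ltnn addn0.
rewrite lt big1 // => N _.
have -> : (kap j.+1 t == kap N t) = false; last by rewrite andbF.
by rewrite gtn_eqF// (leq_ltn_trans _ lt)// kap_homo// -ltnS.
Qed.

Lemma sum_piece L t : (0 < L)%N -> \sum_(N < L) piece L N t = f L t.
Proof.
move=> L0; rewrite /piece; under eq_bigr do rewrite mulrDr.
rewrite big_split /=.
have -> : \sum_(N < L) (new_level N t)%:R * ((N == 0%N :> nat)%:R * f 0 t) = f 0 t.
  case: L L0 => // L _; rewrite big_ord_recl /= !mul1r big1 ?addr0// => i _.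
  by rewrite mul0r mulr0.
have -> : \sum_(N < L) (new_level N t)%:R *
    (\sum_(j < L) ((N <= j)%N && (kap j t == kap N t))%:R * mart_diff j t) =
    \sum_(j < L) mart_diff j t.
  under eq_bigr do rewrite mulr_sumr.
  rewrite exchange_big /=; apply: eq_bigr => j _.
  transitivity ((\sum_(N < L) nat_of_bool (new_level N t &&
    ((N <= j) && (kap j t == kap N t))))%N%:R * mart_diff j t); last first.
    by rewrite sum_new_level// mul1r.
  rewrite natr_sum mulr_suml; apply: eq_bigr => N _.
  by rewrite mulrA -natrM mulnb.
rewrite -(big_mkord xpredT (mart_diff^~ t)) telescope_sumr// addrC subrK//.
Qed.

(** The sum is the martingale stopped at [s], the first time after [N] at which the height has
    jumped, capped at [J]. An increment is added only while the height is unchanged, so the bound at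
    j+1 also covers the value reached at the jump. *)
Lemma piece_sum_stop lam N t J : (N <= J)%N -> nrm (f N t) <= lam ->
  (forall j, kap j t = kap N t -> nrm (f j.+1 t) <= lam) ->
  exists s, [/\ (s <= J)%N, nrm (f s t) <= lam, (s < J -> kap N t < kap s t)%N &
   \sum_(j < J) ((N <= j)%N && (kap j t == kap N t))%:R * mart_diff j t = f s t - f N t].
Proof.
move=> /subnK <- fN flam; elim: (J - N)%N => [|d [s [sJ slam skap IH]]].
  rewrite add0n; exists N; split => //; first by rewrite ltnn.
  rewrite subrr big1// => j _.
  by rewrite leqNgt ltn_ord mul0r.
rewrite addSn big_ord_recr /= IH leq_addl /=; set K := (d + N)%N in sJ skap IH *.
have kNJ : (kap N t <= kap K t)%N by rewrite kap_homo// leq_addl.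
case: eqP => [e|ne].
  have sE : s = K.
    apply/eqP; rewrite eqn_leq sJ leqNgt; apply/negP => sltJ.
    by have := skap sltJ; have := kap_homo t sJ; lia.
  exists K.+1; split => //; [exact: flam|by rewrite ltnn|].
  by rewrite sE /mart_diff mul1r; ring.
exists s; split => //; [exact: leqW| |by rewrite mul0r addr0].
rewrite ltnS => _; have [/skap//|Js] := ltnP s K.
have -> : s = K by apply/eqP; rewrite eqn_leq sJ.
by rewrite ltn_neqAle kNJ andbT; apply/eqP => e; exact: ne.
Qed.

Lemma normc_piece_le lam L N t : (N < L)%N -> nrm (f N t) <= lam ->
  (forall j, kap j t = kap N t -> nrm (f j.+1 t) <= lam) ->
  nrm (piece L N t) <= (new_level N t)%:R * (2 * lam).
Proof.
move=> NL fN flam.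
have lam0 : 0 <= lam by apply: le_trans fN; exact: normc_ge0.
rewrite /piece; case: new_level; last by rewrite !mul0r Normc.normc0.
rewrite !mul1r; have [s [_ slam _ ->]] := piece_sum_stop (ltnW NL) fN flam.
case: N {NL} fN flam => [|N] fN flam /=.
  by rewrite mul1r addrC subrK; lra.
by rewrite mul0r add0r; apply: le_trans (normcB _ _) _; lra.
Qed.

Lemma new_level_level N : level m N (new_level N).
Proof.
case: N => // N t /=; rewrite -kap_level; congr (_ < _)%N.
exact: (levelW (leqnSn N) (kap_level N)).
Qed.

Definition cylinder_piece L N c t : R[i] := (t %% M N == c %% M N)%N%:R * piece L N t.

(** Every increment at time j >= N is multiplied by factors known at time [j] (cylinder, new level,
    unchanged height), so [sum_mart_diff] annihilates it. *)
Lemma sum_cylinder_piece L N c : (0 < N <= L)%N -> \sum_(t < M L) cylinder_piece L N c t = 0.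
Proof.
move=> /andP[N0 NL]; rewrite /cylinder_piece /piece gtn_eqF//.
under eq_bigr => t _ do rewrite mul0r add0r mulr_sumr mulr_sumr.
rewrite exchange_big big1//= => j _.
under eq_bigr => t _ do rewrite mulrA mulrA.
have [Nj|jN] := leqP N j; last first.
  by apply: big1 => t _; rewrite mulr0 mul0r.
apply: (@sum_mart_diff L j (fun t => (t %% M N == c %% M N)%N%:R *
  (new_level N t)%:R * (kap j t == kap N t)%:R) (ltn_ord j)) => t; congr (_ * _).
  congr (_ * _); first by rewrite modn_gen_power.
  by congr (_%:R); congr nat_of_bool; exact: (levelW Nj (@new_level_level N)).
rewrite -kap_level; congr (_%:R); congr nat_of_bool; congr (_ == _).
exact: (levelW Nj (kap_level N)).
Qed.

Lemma sum_cylinder_pieceE L N t : \sum_(c < M N) cylinder_piece L N c t = piece L N t.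
Proof.
have tM : (t %% M N < M N)%N by rewrite ltn_mod (gen_power_gt0 hm).
rewrite (bigD1 (Ordinal tM))//= {1}/cylinder_piece modn_mod eqxx mul1r.
rewrite big1 ?addr0// => c /eqP cN; rewrite /cylinder_piece (modn_small (ltn_ord c)).
case: eqP => [e|_]; last by rewrite mul0r.
by exfalso; apply: cN; apply: val_inj; rewrite /= e.
Qed.

(** The heights at successive new levels are distinct increasing integers, so the powers of 2 add up
    to at most twice the last one. *)
Lemma sum_new_level_geometric J t :
  \sum_(N < J.+1) (new_level N t)%:R * 2 ^+ kap N t <= 2 * 2 ^+ kap J t :> R.
Proof.
elim: J => [|J IH].
  by rewrite big_ord1 /= mul1r ler_peMl ?exprn_ge0// ler1n.
rewrite big_ord_recr /=.
have := kap_mono J t; rewrite leq_eqVlt => /orP[/eqP e|lt].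
  by rewrite -e ltnn mul0r addr0.
rewrite lt mul1r.
have : 2 * 2 ^+ kap J t <= 2 ^+ kap J.+1 t :> R.
  by rewrite -exprS ler_weXn2l// ler1n.
by move: IH; lra.
Qed.

End AtomicDecomposition.

(** * The maximal estimate on the finite group *)

Section FiniteBound.
Variables (R : realType) (m : nat -> nat) (B : nat).
Hypothesis hm : forall n, (2 <= m n <= B)%N.
Local Notation M := (gen_power m).
Variables (alpha C0 C1 C2 : R).
Hypothesis a01 : 0 < alpha <= 1.
Variable q : nat -> R.
Hypothesis qdec : nonincreasing_seq q.
Hypothesis q_ge0 : forall n, 0 <= q n.
Hypothesis q0 : 0 < q 0%N.
Hypothesis q0C : q 0%N <= C0.
Hypothesis hQO : forall n, (0 < n)%N -> n%:R `^ alpha / Qsum q n <= C1.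
Hypothesis hqO : forall n, (0 < n)%N ->
  (q n - q n.+1) / (n%:R `^ (alpha - 2)) <= C2.
Local Notation p := ((1 + alpha)^-1 : R).

Variable f : nat -> nat -> R[i].
Hypothesis f_level : forall n, level m n (f n).
Hypothesis f_mart : forall n y, (y < M n)%N ->
  \sum_(a < m n) f n.+1 (y + a * M n)%N = f n y *+ m n.

Fixpoint running_max (n x : nat) : R :=
  if n is n'.+1 then Num.max (running_max n' x) (nrm (f n x) `^ p)
  else nrm (f 0 x) `^ p.

Lemma running_max_level n : level m n (running_max n).
Proof.
elim: n => [|n IH] x /=; first by rewrite [in LHS]f_level.
rewrite [in LHS]f_level; congr (Num.max _ _).
exact: (levelW (leqnSn n) IH).
Qed.

Lemma running_maxS n x : running_max n x <= running_max n.+1 x.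
Proof. by rewrite /= le_max lexx. Qed.

Lemma le_running_max n x : nrm (f n x) `^ p <= running_max n x.
Proof. by case: n => [|n] /=; rewrite ?le_max ?lexx ?orbT. Qed.

Lemma running_max_ge0 n x : 0 <= running_max n x.
Proof. exact: le_trans (powR_ge0 _ _) (le_running_max n x). Qed.

Let p0 : 0 < p. Proof. by case/andP: (Hardy_exponent_bounds a01). Qed.

Lemma le_powR_inv (a X : R) : 0 <= a -> a `^ p <= X -> a <= X `^ (1 + alpha).
Proof.
have /andP[al0 _] := a01; move=> a0 aX.
have -> : a = (a `^ p) `^ (1 + alpha).
  by rewrite -powRrM mulVf ?powRr1//; lra.
by apply: ge0_ler_powR; rewrite ?nnegrE ?powR_ge0// ?(le_trans (powR_ge0 _ _) aX)//; lra.
Qed.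

Local Notation lmean := (level_mean m q).

Lemma level_mean_sum (I : finType) L (b : I -> nat -> R[i]) n x :
  lmean L (fun t => \sum_i b i t) n x = \sum_i lmean L (b i) n x.
Proof.
rewrite /level_mean -!mulr_sumr; congr (_ * (_ * _)).
rewrite exchange_big; apply: eq_bigr => t _; exact: mulr_suml.
Qed.

Variables (eps : R) (e0 : 0 < eps).

Let v := predictable m running_max.
Let kap n x := dyadic_index e0 (v n x).

Let v_level n : level m n (v n).
Proof. exact: (predictable_level running_max_level). Qed.

Let kap_level n : level m n (kap n).
Proof. by move=> x; rewrite /kap v_level. Qed.

Let v_mono n x : v n x <= v n.+1 x.
Proof. exact: (predictable_mono running_max_level running_maxS). Qed.

Let kap_mono n x : (kap n x <= kap n.+1 x)%N.
Proof. exact: dyadic_index_mono. Qed.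

(** The dyadic height bounds |f|^p, so the power 1 + alpha = 1/p bounds |f|; the 2 comes from the
    two values whose difference is a piece. It is constant on cylinders of level [N], hence serves
    as the coefficient of an atom. *)
Definition atom_height N c : R :=
  (new_level kap N c)%:R * (2 * (eps * 2 ^+ kap N c) `^ (1 + alpha)).

Lemma atom_height_ge0 N c : 0 <= atom_height N c.
Proof. by rewrite mulr_ge0// mulr_ge0// powR_ge0. Qed.

Lemma level_atom_height N : level m N (atom_height N).
Proof.
move=> x; rewrite /atom_height; congr (_%:R * (2 * (eps * 2 ^+ _) `^ _)).
  by congr nat_of_bool; apply: new_level_level.
exact: kap_level.
Qed.

Lemma normc_piece_le_height L N t : (N < L)%N ->
  nrm (piece f kap L N t) <= atom_height N t.
Proof.
move=> NL; apply: (normc_piece_le kap_mono NL).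
  apply: le_powR_inv; first exact: normc_ge0.
  apply: le_trans (le_running_max _ _) (le_trans _ (le_dyadic_index e0 _)).
  case: N {NL} => [|N]; last first.
    exact: le_trans (phi_le_predictable hm running_max_level running_maxS _ _) (v_mono _ _).
  apply: le_trans (running_maxS _ _) _.
  exact: (phi_le_predictable hm running_max_level running_maxS).
move=> j e; apply: le_powR_inv; first exact: normc_ge0.
rewrite -e; apply: le_trans (le_running_max _ _) (le_trans _ (le_dyadic_index e0 _)).
exact: (phi_le_predictable hm running_max_level running_maxS).
Qed.

Lemma sum_atom_height_powR J t :
  \sum_(N < J.+1) atom_height N t `^ p <= 2 `^ p * 2 * (eps + 2 * v J t).
Proof.
have hE N : atom_height N t `^ p = 2 `^ p * eps * ((new_level kap N t)%:R * 2 ^+ kap N t).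
  rewrite /atom_height; move: (new_level kap N t) (kap N t) => b k.
  have E0 : 0 <= eps * 2 ^+ k by rewrite mulr_ge0 ?exprn_ge0// ltW.
  rewrite powRM ?mulr_ge0 ?powR_ge0//.
  rewrite powR_nat_of_bool ?gt_eqF// powRM ?powR_ge0// -powRrM divff; last first.
    by have /andP[al0 _] := a01; lra.
  by rewrite powRr1//; ring.
under eq_bigr do rewrite hE.
rewrite -mulr_sumr.
apply: (@le_trans _ _ (2 `^ p * eps * (2 * 2 ^+ kap J t))).
  by rewrite ler_wpM2l ?mulr_ge0 ?powR_ge0 ?(ltW e0)//; exact: (sum_new_level_geometric R kap_mono).
have -> : 2 `^ p * eps * (2 * 2 ^+ kap J t) = 2 `^ p * 2 * (eps * 2 ^+ kap J t).
  by move: (kap J t) => k; ring.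
rewrite ler_wpM2l ?mulr_ge0 ?powR_ge0//; apply: dyadic_index_le.
apply: le_trans (phi_le_predictable hm running_max_level running_maxS _ _).
exact: running_max_ge0.
Qed.

Definition finite_const : R := avg_atom_const B alpha C0 C1 C2 * (2 `^ p * 2).

Lemma avg_atom_const_ge0 : 0 <= avg_atom_const B alpha C0 C1 C2.
Proof.
rewrite /avg_atom_const; apply: mulr_ge0.
  by rewrite mulr_ge0 ?powR_ge0// divr_ge0// ln_ge0// ler1n.
rewrite addr_ge0// divr_ge0// subr_ge0 -[leLHS](one_powR p).
by apply: ge0_ler_powR; rewrite ?nnegrE ?(ltW p0)// ler1n.
Qed.

Lemma finite_const_ge0 : 0 <= finite_const.
Proof. by rewrite /finite_const mulr_ge0 ?avg_atom_const_ge0// mulr_ge0 ?powR_ge0. Qed.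

Lemma finite_norlund_bound L : (0 < L)%N -> exists U : nat -> R,
  (forall n x, (0 < n <= M L)%N ->
    nrm (lmean L (f L) n x) `^ p / ln n.+1%:R <= U x) /\
  avg m L U <= finite_const * (eps + 2 * (B%:R * avg m L (running_max L))).
Proof.
move=> L0.
pose U N x := \sum_(c < M N) atom_majorant m B alpha C0 C1 C2 (atom_height N c) N c x.
exists (fun x => \sum_(N < L) U N x); split.
  move=> n x nL; have /andP[n0 _] := nL.
  have lnn0 : 0 < ln n.+1%:R :> R by rewrite ln_gt0// ltr1n.
  have -> : f L = fun t => \sum_(N < L) \sum_(c < M N) cylinder_piece m f kap L N c t.
    apply/funext => t; rewrite -(sum_piece f kap_mono t L0); apply: eq_bigr => N _.
    by rewrite (sum_cylinder_pieceE hm).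
  rewrite level_mean_sum.
  apply: (@le_trans _ _ (\sum_(N < L) \sum_(c < M N)
     nrm (lmean L (cylinder_piece m f kap L N c) n x) `^ p / ln n.+1%:R)).
    under eq_bigr do rewrite level_mean_sum.
    under [leRHS]eq_bigr do rewrite -mulr_suml.
    rewrite -mulr_suml ler_wpM2r ?invr_ge0 ?(ltW lnn0)//.
    apply: (@le_trans _ _ ((\sum_(N < L) \sum_(c < M N)
        nrm (lmean L (cylinder_piece m f kap L N c) n x)) `^ p)).
      apply: ge0_ler_powR; rewrite ?nnegrE ?normc_ge0 ?(ltW p0)//.
        by apply: sumr_ge0 => N _; apply: sumr_ge0 => c _; exact: normc_ge0.
      apply: le_trans (normc_sum _ _ _) _; apply: ler_sum => N _; exact: normc_sum.
    apply: le_trans (powR_sum_le _ (Hardy_exponent_bounds a01) _) _.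
      by move=> N _; apply: sumr_ge0 => c _; exact: normc_ge0.
    apply: ler_sum => N _; apply: (powR_sum_le _ (Hardy_exponent_bounds a01)) => c _.
    exact: normc_ge0.
  apply: ler_sum => N _; apply: ler_sum => c _.
  have NL := ltn_ord N.
  apply: (atom_mean_powR_bound hm a01 qdec q_ge0 q0 q0C hQO hqO) nL => //.
  - exact: ltnW.
  - exact: atom_height_ge0.
  - move=> t; rewrite /cylinder_piece (agree_same_digit R hm) Normc.normcM normc_nat eq_sym.
    case: eqP => [e|_]; last by rewrite mul0r mulr0.
    rewrite mul1r mulr1; apply: le_trans (normc_piece_le_height t NL) _.
    by rewrite level_atom_height -e -level_atom_height.
  - have [N0|N0] := posnP N; [by left|right].
    by apply: (sum_cylinder_piece hm f_level f_mart kap_level); rewrite N0 ltnW.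
rewrite (avg_sum m (index_enum _) L (fun (N : 'I_L) x => U N x)).
set K := avg_atom_const B alpha C0 C1 C2.
(* Each cylinder of level [N] contributes height^p / M_N, and summing over the [M N] cylinders gives
   exactly an average. *)
apply: (@le_trans _ _ (\sum_(N < L) K * avg m L (fun t => atom_height N t `^ p))).
  apply: ler_sum => N _; rewrite /U.
  rewrite (avg_sum m (index_enum _) L (fun (c : 'I_(M N)) x => _)).
  have NL : (N <= L)%N by rewrite ltnW.
  rewrite (avg_level hm NL); last first.
    by move=> t; rewrite -level_atom_height.
  rewrite /avg !mulr_sumr; apply: ler_sum => c _.
  apply: le_trans (avg_atom_majorant hm C0 C1 C2 a01 c NL (atom_height_ge0 N c)) _.
  by rewrite -/K [in leRHS]mulrCA mulrC mulrA; rewrite le_eqVlt; apply/orP; left; apply/eqP; ring.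
rewrite -mulr_sumr -(avg_sum m (index_enum _) L (fun (N : 'I_L) t => atom_height N t `^ p)).
have K0 : 0 <= K by exact: avg_atom_const_ge0.
rewrite /finite_const -/K -mulrA ler_wpM2l//.
case: L L0 {U} => // J _.
apply: le_trans (avg_le _ _ (sum_atom_height_powR J)) _.
rewrite avgZ ler_wpM2l ?mulr_ge0 ?powR_ge0//.
rewrite avgD (avg_cst hm) avgZ lerD2l ler_wpM2l//.
exact: (avg_predictable hm running_max_level running_maxS running_max_ge0).
Qed.

End FiniteBound.

(** * Integration of cylindrical functions *)

Section Cylinders.
Variables (R : realType) (m : nat -> nat) (B : nat).
Hypothesis hm : forall n, (2 <= m n <= B)%N.
Local Notation M := (gen_power m).
Local Notation pt := (pt m).
Implicit Types x y : vilenkin m.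

Definition code (L : nat) x : nat := \sum_(k < L) (x k : nat) * M k.

Lemma codeS L x : code L.+1 x = (code L x + (x L : nat) * M L)%N.
Proof. by rewrite /code big_ord_recr. Qed.

Lemma code_lt L x : (code L x < M L)%N.
Proof.
elim: L => [|L IH]; first by rewrite /code big_ord0 gen_power0.
rewrite codeS gen_powerS.
apply: (@leq_trans ((x L).+1 * M L)); first by rewrite mulSn ltn_add2r.
by rewrite leq_mul2r (ltn_coord hm) orbT.
Qed.

Lemma code_mod l L x : (l <= L)%N -> (code L x %% M l = code l x)%N.
Proof.
move=> /subnK <-; elim: (L - l)%N => [|d IH].
  by rewrite add0n modn_small// code_lt.
by rewrite addSn codeS modn_shift ?leq_addl.
Qed.

Lemma digit_code L x k : (k < L)%N -> digit m (code L x) k = x k.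
Proof.
move=> kL; rewrite -(digit_modn hm _ (ltnSn k)) code_mod// codeS.
by rewrite (digit_top hm) ?code_lt// (ltn_coord hm).
Qed.

Lemma pt_code L x k : (k < L)%N -> pt (code L x) k = x k.
Proof. by move=> kL; apply/val_inj/(etrans (pt_digit hm _ _))/digit_code. Qed.

Lemma code_pt L c : code L (pt c) = (c %% M L)%N.
Proof.
elim: L => [|L IH]; first by rewrite /code big_ord0 gen_power0 modn1.
by rewrite codeS IH (digit_split hm) (pt_digit hm).
Qed.

Lemma vintE n c : vint n (pt c) = [set x | code n x = c %% M n]%N.
Proof.
apply/seteqP; split => x /= h.
  by rewrite -code_pt; apply: eq_bigr => k _; rewrite h.
move=> k kn; rewrite -(pt_code x kn) h; apply: val_inj.
exact: etrans (pt_digit hm _ _) (etrans (digit_modn hm _ kn) (esym (pt_digit hm _ _))).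
Qed.

Lemma measurable_cylinder n c : measurable [set x | code n x = c]%N.
Proof.
have [cM|Mc] := ltnP c (M n); last first.
  rewrite (_ : [set _ | _] = set0)//; apply/seteqP; split => // x /= e.
  by have := code_lt n x; rewrite e ltnNge Mc.
rewrite -(modn_small cM) -vintE; apply: sub_sigma_algebra; by exists n, (pt c).
Qed.

Lemma measurable_code (d : measure_display) (T : measurableType d) L (F : nat -> T) :
  measurable_fun setT (fun x => F (code L x)).
Proof.
move=> _ Y _; rewrite setTI.
rewrite (_ : _ @^-1` _ = \bigcup_(c in [set c | Y (F c)]) [set x | code L x = c]%N).
  by apply: bigcup_measurable => c _; exact: measurable_cylinder.
by apply/seteqP; split => [x /= h|x [c /= h e]]; [exists (code L x)|rewrite e].
Qed.

Variable mu : probability (vilenkin m) R.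
Hypothesis hmu : is_haar mu.

Lemma measure_cylinder n c : (c < M n)%N ->
  mu [set x | code n x = c]%N = ((M n)%:R^-1)%:E.
Proof.
move=> cM; have := hmu n (fun k => [set pt c k]%SET).
rewrite (_ : [set _ | _] = [set x | code n x = c]%N); last first.
  rewrite -[in RHS](modn_small cM) -vintE; apply/seteqP.
  by split => x /= h k /h; rewrite inE => /eqP.
move=> ->; congr (_%:E).
under eq_bigr do rewrite cards1 mul1r.
by rewrite prodfV -natr_prod.
Qed.

Lemma integral_code L (F : nat -> R) :
  (\int[mu]_x (F (code L x))%:E = (avg m L F)%:E)%E.
Proof.
have -> : (fun x => (F (code L x))%:E) =
    (fun x => \sum_(c < M L) ((F c)%:E * (\1_[set y | code L y = c]%N x)%:E))%E.
  apply/funext => x; rewrite (bigD1 (Ordinal (code_lt L x)))//= big1.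
    by rewrite adde0 indicE mem_set// mule1.
  move=> c /eqP cx; rewrite indicE memNset ?mule0//= => e; apply: cx.
  by apply: val_inj.
rewrite integral_sum//; last first.
  by move=> c; apply: integrableZl => //; apply: integrable_indic => //; exact: measurable_cylinder.
rewrite /avg mulr_sumr -sumEFin; apply: eq_bigr => c _.
rewrite integralZl//; last by apply: integrable_indic => //; exact: measurable_cylinder.
rewrite integral_indic ?setIT//; last exact: measurable_cylinder.
rewrite mulrC EFinM; congr (_ * _)%E.
exact: measure_cylinder.
Qed.

Definition cavg L (F : nat -> R[i]) : R[i] := (M L)%:R^-1%:C%C * \sum_(t < M L) F t.

Lemma cintegral_code L (F : nat -> R[i]) :
  cintegral mu setT (fun x => F (code L x)) = cavg L F.
Proof.
rewrite /cintegral /Rintegral.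
rewrite (integral_code L (fun c => complex.Re (F c))).
rewrite (integral_code L (fun c => complex.Im (F c))) /=.
rewrite /cavg /avg; have -> : \sum_(t < M L) F t =
  Complex (\sum_(t < M L) complex.Re (F t)) (\sum_(t < M L) complex.Im (F t)).
  elim/big_rec3: _ => [|i x y z _ ->]//.
  by case: (F i).
by apply/eqP; rewrite eq_complex /= !mul0r subr0 addr0 !eqxx.
Qed.

End Cylinders.

(** * Transfer of martingales and their means to codes *)

Section MartingaleCodes.
Variables (R : realType) (m : nat -> nat) (B : nat).
Hypothesis hm : forall n, (2 <= m n <= B)%N.
Local Notation M := (gen_power m).
Local Notation pt := (pt m).
Implicit Types x y : vilenkin m.

(** The sets that do not separate points agreeing on [n] coordinates form a sigma-algebra containing
    the generating cylinders. *)
Lemma filtration_saturated n (A : set (vilenkin m)) x y :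
  filtration n A -> (forall k, (k < n)%N -> y k = x k) -> A x -> A y.
Proof.
move=> hA; move: x y.
suff : filtration n `<=` [set A | forall x y, (forall k, (k < n)%N -> y k = x k) -> A x -> A y].
  by apply.
apply: smallest_sub; last first.
  by move=> _ [z _ <-] x y xy /= h k kn; rewrite xy// h.
split=> //=.
  by move=> C hC x y xy [_ nCx]; split => // Cy; apply: nCx; apply: hC Cy => k /xy ->.
by move=> C hC x y xy [i _ Ci]; exists i => //; exact: hC xy Ci.
Qed.

Lemma adapted_cylinder n (h : vilenkin m -> R[i]) x y : adapted n h ->
  (forall k, (k < n)%N -> y k = x k) -> h y = h x.
Proof.
move=> hh xy.
have [hRe _] := hh [set complex.Re (h x)] (measurable_set1 _).
have [_ hIm] := hh [set complex.Im (h x)] (measurable_set1 _).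
have := filtration_saturated hRe xy erefl; have := filtration_saturated hIm xy erefl.
by move=> /= e1 e2; apply/eqP; rewrite eq_complex e1 e2 !eqxx.
Qed.

Variable mu : probability (vilenkin m) R.
Hypothesis hmu : is_haar mu.
Variable f : nat -> vilenkin m -> R[i].
Hypothesis hf : is_martingale mu f.

Definition coded (n c : nat) : R[i] := f n (pt c).

Lemma coded_code n L x : (n <= L)%N -> f n x = coded n (code L x).
Proof.
case: hf => had _ _ nL; apply/esym/(adapted_cylinder (had n)) => k kn.
by rewrite (pt_code hm)// (leq_trans kn).
Qed.

Lemma level_coded n : level m n (coded n).
Proof.
move=> c; rewrite {1}/coded (@coded_code n n)//; congr coded.
exact: code_pt.
Qed.

Lemma integral_cylinder n c L (F : nat -> R) : (n <= L)%N ->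
  (\int[mu]_(x in [set x | code n x = c]%N) (F (code L x))%:E =
   (avg m L (fun t => (t %% M n == c)%N%:R * F t))%:E)%E.
Proof.
move=> nL; rewrite -(integral_code hm hmu) integral_mkcond; congr integral; apply/funext => x.
rewrite patchE; have [e|e] := eqVneq (code n x) c.
  by rewrite mem_set// (code_mod hm)// e eqxx mul1r.
by rewrite memNset /=; [rewrite (code_mod hm)// (negPf e) mul0r|apply/eqP].
Qed.

Lemma cintegral_cylinder n c L (F : nat -> R[i]) : (n <= L)%N ->
  cintegral mu [set x | code n x = c]%N (fun x => F (code L x)) =
  cavg m L (fun t => (t %% M n == c)%N%:R * F t).
Proof.
move=> nL; rewrite -(cintegral_code hm hmu) /cintegral /Rintegral.
rewrite (integral_cylinder c (fun c => complex.Re (F c)) nL).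
rewrite (integral_cylinder c (fun c => complex.Im (F c)) nL).
have E0 (b : bool) (z : R[i]) : complex.Re (b%:R * z) = b%:R * complex.Re z /\
    complex.Im (b%:R * z) = b%:R * complex.Im z.
  by case: b; rewrite ?mul1r ?mul0r.
rewrite (integral_code hm hmu L (fun t => complex.Re ((t %% M n == c)%N%:R * F t))).
rewrite (integral_code hm hmu L (fun t => complex.Im ((t %% M n == c)%N%:R * F t))) /=.
by congr Complex; congr avg; apply/funext => t; have [] := E0 (t %% M n == c)%N (F t).
Qed.

Lemma coded_mart n (y : nat) : (y < M n)%N ->
  \sum_(a < m n) coded n.+1 (y + a * M n)%N = coded n y *+ m n.
Proof.
move=> yM; case: hf => _ _ /(_ n n.+1 (vint n (pt y)) (leqnSn n)) h.
have hv : filtration n (vint n (pt y)) by apply: sub_gen_smallest; exists (pt y).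
have {h} := h hv.
rewrite (vintE hm) modn_small//.
have -> : f n.+1 = fun x => coded n.+1 (code n.+1 x).
  by apply/funext => x; rewrite -coded_code.
have -> : f n = fun x => coded n (code n.+1 x).
  by apply/funext => x; rewrite -coded_code.
rewrite !cintegral_cylinder//.
have Mn : (M n.+1)%:R^-1%:C%C != 0 :> R[i].
  by rewrite eq_complex /= eqxx andbT invr_eq0 (gen_power_ne0 _ hm).
move/(mulfI Mn).
have sumE (F : nat -> R[i]) :
    \sum_(t < M n.+1) (t %% M n == y)%N%:R * F t = \sum_(a < m n) F (y + a * M n)%N.
  rewrite (sum_gen_powerS m n (fun t => (t %% M n == y)%N%:R * F t)).
  apply: eq_bigr => a _; rewrite (bigD1 (Ordinal yM))//= big1 ?addr0.
    by rewrite modn_shift// modn_small// eqxx mul1r.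
  move=> z /eqP zy; rewrite modn_shift// modn_small//.
  by case: eqP => [e|_]; rewrite ?mul0r//; case: zy; apply: val_inj.
rewrite !sumE => ->.
under eq_bigr do rewrite (level_add _ _ (@level_coded n)).
by rewrite sumr_const card_ord.
Qed.

(** The martingale property tested against a function of the first [L] coordinates; it makes the
    limit defining a Fourier coefficient eventually constant. *)
Lemma cavg_coded k L (w : nat -> R[i]) : level m L w -> (L <= k)%N ->
  cavg m k (fun t => coded k t * w t) = cavg m L (fun t => coded L t * w t).
Proof.
move=> hw /subnK <-; elim: (k - L)%N => [|d IH]//.
rewrite addSn -{}IH; set j := (d + L)%N.
have hwj : level m j w by apply: levelW hw; rewrite leq_addl.
rewrite /cavg (sum_gen_powerS m j (fun t => coded j.+1 t * w t)) exchange_big /=.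
under eq_bigr => y _.
  under eq_bigr => a _ do rewrite (level_add _ _ hwj).
  rewrite -mulr_suml coded_mart// mulrnAl -mulr_natr; over.
rewrite -mulr_suml mulrA mulrAC; congr (_ * _).
have m0 : (m j)%:R != 0 :> R by rewrite gt_eqF// (base_gt0R R hm).
rewrite -(rmorph_nat (real_complex R)) -rmorphM /= gen_powerS natrM invfM mulrAC mulVf//.
by rewrite mul1r.
Qed.

Lemma fourier_coefE i L : (i < M L)%N ->
  fourier_coef mu f i = cavg m L (fun t => coded L t * conjc (psi R i (pt t))).
Proof.
move=> iL; rewrite /fourier_coef; apply: (@norm_lim_near_cst _ (R[i]^o)); near=> k.
have Lk : (L <= k)%N by near: k; exact: nbhs_infty_ge.
have hw : level m L (fun t => conjc (psi R i (pt t))).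
  by move=> t; rewrite (psi_pt_level R hm iL).
rewrite -(cavg_coded hw Lk) -(cintegral_code hm hmu); congr cintegral.
apply/funext => x; rewrite (@coded_code k k)//; congr (_ * conjc _).
rewrite (psi_widen _ hm _ iL) (psi_widen _ hm _ iL); apply: eq_bigr => j _.
by rewrite /rademacher (pt_code hm)// (leq_trans (ltn_ord j)).
Unshelve. all: by end_near. Qed.

Lemma norlund_meanE q n L x : (n <= M L)%N ->
  norlund_mean mu q f n x = level_mean m q L (coded L) n (code L x).
Proof.
move=> nL; rewrite /norlund_mean /level_mean; congr (_ * _).
transitivity (\sum_(1 <= k < n.+1) \sum_(t < M L) (M L)%:R^-1%:C%C *
   (coded L t * ((q (n - k)%N)%:C%C * dirichlet (character_kernel R m (code L x) t) k))).
  apply: eq_big_nat => k /andP[_ kn].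
  rewrite /partial_sum /dirichlet mulr_sumr.
  under [RHS]eq_bigr do rewrite !mulr_sumr.
  rewrite exchange_big /=; apply: eq_bigr => i _.
  have iL : (i < M L)%N by have := ltn_ord i; lia.
  rewrite (fourier_coefE iL) /cavg mulr_sumr mulr_suml mulr_sumr.
  apply: eq_bigr => t _; rewrite /character_kernel.
  have -> : psi R i (pt (code L x)) = psi R i x.
    rewrite !(psi_widen _ hm _ iL); apply: eq_bigr => j _.
    by rewrite /rademacher (pt_code hm).
  by ring.
rewrite exchange_big /= mulr_sumr; apply: eq_bigr => t _.
by rewrite /norlund_kernel !mulr_sumr.
Qed.

End MartingaleCodes.

(** * The maximal inequality *)

Section MaximalInequality.
Variables (R : realType) (m : nat -> nat) (B : nat).
Hypothesis hm : forall n, (2 <= m n <= B)%N.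
Local Notation M := (gen_power m).
Variable mu : probability (vilenkin m) R.
Hypothesis hmu : is_haar mu.
Variables (alpha C0 C1 C2 : R).
Hypothesis a01 : 0 < alpha <= 1.
Variable q : nat -> R.
Hypothesis qdec : nonincreasing_seq q.
Hypothesis q_ge0 : forall n, 0 <= q n.
Hypothesis q0 : 0 < q 0%N.
Hypothesis q0C : q 0%N <= C0.
Hypothesis hQO : forall n, (0 < n)%N -> n%:R `^ alpha / Qsum q n <= C1.
Hypothesis hqO : forall n, (0 < n)%N ->
  (q n - q n.+1) / (n%:R `^ (alpha - 2)) <= C2.
Variable f : nat -> vilenkin m -> R[i].
Hypothesis hf : is_martingale mu f.
Local Notation p := ((1 + alpha)^-1 : R).
Implicit Types x : vilenkin m.

Let p0 : 0 < p. Proof. by case/andP: (Hardy_exponent_bounds a01). Qed.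
Let alpha1 : 1 + alpha != 0. Proof. by have /andP[] := a01; lra. Qed.

Lemma maximal_ge0 x : (0 <= maximal f x)%E.
Proof.
by apply: le_trans (ereal_sup_ubound _); last (exists 0%N => //); rewrite lee_fin normc_ge0.
Qed.

Lemma le_poweR (a b : \bar R) r : 0 <= r -> (0 <= a)%E -> (a <= b)%E -> (a `^ r <= b `^ r)%E.
Proof.
move=> r0 a0 ab; apply: gt0_ler_poweR => //; rewrite in_itv /= leey andbT//.
exact: le_trans ab.
Qed.

Lemma measurable_maximal : measurable_fun setT (maximal f).
Proof.
rewrite (_ : maximal f = fun x => esups (fun n => (nrm (f n x))%:E) 0).
  apply: measurable_fun_esups => n.
  rewrite (_ : (fun _ => _) = fun x => (nrm (coded f n (code n x)))%:E).
    exact: (measurable_code hm n (fun c => (nrm (coded f n c))%:E)).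
  by apply/funext => x; rewrite -(coded_code hm hf).
apply/funext => x; rewrite /maximal /esups /sdrop /=; congr ereal_sup.
by apply/seteqP; split => _ [n _ <-]; exists n.
Qed.

Lemma running_max_le_maximal L x :
  ((running_max alpha (coded f) L (code L x))%:E <= maximal f x `^ p)%E.
Proof.
have h n : (n <= L)%N -> ((nrm (coded f n (code L x)) `^ p)%:E <= maximal f x `^ p)%E.
  move=> nL; rewrite -poweR_EFin; apply: le_poweR; rewrite ?(ltW p0)// ?lee_fin ?normc_ge0//.
  by apply: ereal_sup_ubound; exists n => //; rewrite -(coded_code hm hf).
have {h} : forall n, (n <= L)%N ->
    ((running_max alpha (coded f) n (code L x))%:E <= maximal f x `^ p)%E.
  elim=> [|n IH] nL /=; first exact: h.
  by rewrite EFin_max ge_max IH ?(ltnW nL)//= h.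
exact.
Qed.

Let term n x : R := nrm (norlund_mean mu q f n.+1 x) `^ p / ln n.+2%:R.

Let ln_gt0 n : 0 < ln n.+2%:R :> R. Proof. by rewrite ln_gt0// ltr1n. Qed.

Let term_ge0 n x : 0 <= term n x.
Proof. by rewrite divr_ge0 ?powR_ge0// ltW. Qed.

(** Orders up to [M L] only, so that everything depends on the first [L] coordinates. The p-th power
    is already taken, which turns the weight log^(1+alpha) into log; index [n] stands for order
    n+1. *)
Definition truncated_maximal L x : R := \big[Num.max/0]_(n < M L) term n x.

Let level_term L c n : R := nrm (level_mean m q L (coded f L) n.+1 c) `^ p / ln n.+2%:R.

Lemma truncated_maximalE L x :
  truncated_maximal L x = \big[Num.max/0]_(n < M L) level_term L (code L x) n.
Proof. by apply: eq_bigr => n _; rewrite /term (norlund_meanE hm hmu hf q x (ltn_ord n)). Qed.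

Lemma truncated_maximal_ge0 L x : 0 <= truncated_maximal L x.
Proof. exact: bigmax_ge_id. Qed.

Lemma truncated_maximal_homo x : nondecreasing_seq (truncated_maximal^~ x).
Proof.
move=> l L lL; apply: bigmax_le; first exact: truncated_maximal_ge0.
move=> n _; have nL : (n < M L)%N.
  by rewrite (leq_trans (ltn_ord n))// (leq_gen_power hm).
exact: (le_bigmax 0 (fun i : 'I_(M L) => term i x) (Ordinal nL)).
Qed.

Lemma norlund_maximal_ge0 x : (0 <= norlund_maximal mu q alpha f x)%E.
Proof.
apply: le_trans (ereal_sup_ubound _); last by exists 1%N.
by rewrite lee_fin divr_ge0 ?normc_ge0// powR_ge0.
Qed.

Lemma termE n x :
  (nrm (norlund_mean mu q f n.+1 x) / ln n.+2%:R `^ (1 + alpha)) `^ p = term n x.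
Proof.
rewrite powRM ?normc_ge0 ?invr_ge0 ?powR_ge0// /term; congr (_ * _).
by rewrite -powRN -powRrM mulNr divff// powR_inv1// ltW.
Qed.

(** The p-th power commutes with the supremum since it is increasing with increasing inverse, the
    power 1 + alpha. *)
Lemma norlund_maximal_powE x :
  (norlund_maximal mu q alpha f x `^ p)%E =
  ereal_sup (range (fun L => (truncated_maximal L x)%:E)).
Proof.
set S := ereal_sup _.
have S0 : (0 <= S)%E.
  apply: le_trans (ereal_sup_ubound _); last by exists 0%N.
  by rewrite lee_fin truncated_maximal_ge0.
apply/eqP; rewrite eq_le; apply/andP; split.
  have -> : S = ((S `^ (1 + alpha)) `^ p)%E by rewrite -poweRrM divff// poweRe1.
  apply: le_poweR; rewrite ?(ltW p0)// ?norlund_maximal_ge0//.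
  apply: ge_ereal_sup => _ [[|n] //= _ <-].
  set t := (_ / _)%R.
  have t0 : 0 <= t by rewrite divr_ge0 ?normc_ge0 ?powR_ge0.
  have -> : t%:E = ((t%:E `^ p) `^ (1 + alpha))%E by rewrite -poweRrM mulVf// poweRe1.
  apply: le_poweR; rewrite ?poweR_ge0//; first by have /andP[] := a01; lra.
  (* Index [n] already occurs in the truncation at level [n], because n < M n. *)
  rewrite poweR_EFin termE; apply: (@le_trans _ _ (truncated_maximal n x)%:E).
    rewrite lee_fin.
    exact: (le_bigmax 0 (fun i : 'I_(M n) => term i x) (Ordinal (ltn_id_gen_power hm n))).
  by apply: ereal_sup_ubound; exists n.
apply: ge_ereal_sup => _ [L _ <-]; rewrite /truncated_maximal.
elim/big_ind: _ => [|a b ha hb|n _].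
- exact: poweR_ge0.
- by rewrite EFin_max ge_max ha.
- rewrite -termE -poweR_EFin; apply: le_poweR; rewrite ?(ltW p0)//.
    by rewrite lee_fin divr_ge0 ?normc_ge0 ?powR_ge0.
  by apply: ereal_sup_ubound; exists n.+1.
Qed.

Local Notation K := (finite_const B alpha C0 C1 C2).

Lemma integral_truncated_maximal L (J : R) : (0 < L)%N ->
  (\int[mu]_x maximal f x `^ p)%E = J%:E ->
  (\int[mu]_x (truncated_maximal L x)%:E <= (K * (2 * B%:R) * J)%:E)%E.
Proof.
move=> L0 JE.
have K0 : 0 <= K by exact: finite_const_ge0.
under eq_integral do rewrite truncated_maximalE.
rewrite (integral_code hm hmu L (fun c => \big[Num.max/0]_(n < M L) level_term L c n)).
have avgJ : avg m L (running_max alpha (coded f) L) <= J.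
  rewrite -lee_fin -JE -(integral_code hm hmu); apply: ge0_le_integral => //.
  - move=> x _; rewrite lee_fin running_max_ge0//.
  - exact: (measurable_code hm L (fun c => (running_max alpha (coded f) L c)%:E)).
  - by apply: (measurableT_comp (measurable_poweR p)); exact: measurable_maximal.
  - by move=> x _; exact: running_max_le_maximal.
rewrite lee_fin; apply/ler_addgt0Pr => e e0.
(* This value is used for the lowest dyadic height, so that its contribution [K] times it is at most
   [e]; adding 1 covers K = 0. *)
have d0 : 0 < e / (K + 1) by rewrite divr_gt0//; lra.
have [U [hU avgU]] := finite_norlund_bound hm a01 qdec q_ge0 q0 q0C hQO hqO
  (level_coded hm hf) (coded_mart hm hmu hf) d0 L0.
apply: (@le_trans _ _ (avg m L U)).
  apply: avg_le => c; apply: bigmax_le.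
    (* The maximum has default value 0, so [U] must be nonnegative; the bound at order 1 gives
       this. *)
    apply: le_trans (hU 1%N c _); first by rewrite divr_ge0 ?powR_ge0// ltW.
    by rewrite (gen_power_gt0 hm).
  by move=> n _; apply: hU; rewrite /= ltn_ord.
apply: le_trans avgU _; rewrite mulrDr addrC; apply: lerD.
  by rewrite [2 * _]mulrA [leLHS]mulrA ler_wpM2l// mulr_ge0.
by rewrite mulrCA ger_pMr// ler_pdivrMr; lra.
Qed.

Lemma integral_norlund_maximal (J : R) :
  (\int[mu]_x maximal f x `^ p)%E = J%:E ->
  (\int[mu]_x norlund_maximal mu q alpha f x `^ p <= (K * (2 * B%:R) * J)%:E)%E.
Proof.
move=> JE.
have nd x : {homo (fun L => (truncated_maximal L x)%:E) : l L / (l <= L)%N >-> (l <= L)%E}.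
  by move=> l L lL; rewrite lee_fin truncated_maximal_homo.
under eq_integral => x _.
  rewrite norlund_maximal_powE.
  rewrite -(cvg_lim (@ereal_hausdorff _) (ereal_nondecreasing_cvgn (nd x))).
  over.
have mT L : measurable_fun setT (fun x => (truncated_maximal L x)%:E).
  under eq_fun do rewrite truncated_maximalE.
  exact: (measurable_code hm L (fun c => (\big[Num.max/0]_(n < M L) level_term L c n)%:E)).
rewrite (monotone_convergence mu measurableT mT).
- apply: lime_le; last first.
    near=> L; apply: integral_truncated_maximal => //; near: L; exact: nbhs_infty_gt.
  apply: ereal_nondecreasing_is_cvgn => l L lL; apply: ge0_le_integral => //.
    by move=> x _; rewrite lee_fin truncated_maximal_ge0.
  by move=> x _; exact: nd.
- by move=> L x _; rewrite lee_fin truncated_maximal_ge0.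
- by move=> x _; exact: nd.
Unshelve. all: by end_near. Qed.

End MaximalInequality.

Theorem theorem1 (R : realType) (alpha : R) (halpha : 0 < alpha <= 1)
    (B : nat) (C0 C1 C2 : R) :
  exists c : R,
    forall (m : nat -> nat) (hm : forall n, (2 <= m n <= B)%N)
      (mu : probability (vilenkin m) R) (hmu : is_haar mu)
      (q : nat -> R) (hq_noninc : nonincreasing_seq q)
      (hq_ge0 : forall n, 0 <= q n) (hq0 : 0 < q 0%N) (hq0C : q 0%N <= C0)
      (hQ : Qsum q n @[n --> \oo] --> +oo)
      (hQO : forall n, (0 < n)%N -> n%:R `^ alpha / Qsum q n <= C1)
      (hqO : forall n, (0 < n)%N ->
               (q n - q n.+1) / (n%:R `^ (alpha - 2)) <= C2)
      (f : nat -> vilenkin m -> R[i])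
      (hf : in_Hp mu (1 + alpha)^-1 f),
    ('N[mu]_(((1 + alpha)^-1)%:E)[norlund_maximal mu q alpha f]
       <= c%:E * Hp_norm mu (1 + alpha)^-1 f)%E.
Proof.
(* The constant for the integrals of p-th powers, raised to 1/p = 1 + alpha to pass to
   quasi-norms. *)
exists ((finite_const B alpha C0 C1 C2 * (2 * B%:R)) `^ (1 + alpha)).
move=> m hm mu hmu q hq_noninc hq_ge0 hq0 hq0C _ hQO hqO f [hmart fin].
have a0 : 0 < 1 + alpha by have /andP[] := halpha; lra.
have aN0 : 1 + alpha != 0 by rewrite gt_eqF.
move: fin; rewrite /Hp_norm unlock invrK => fin.
have E x : (`|maximal f x| = maximal f x)%E by rewrite gee0_abs// maximal_ge0.
have E' x : (`|norlund_maximal mu q alpha f x| = norlund_maximal mu q alpha f x)%E.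
  by rewrite gee0_abs// norlund_maximal_ge0.
under eq_integral do rewrite E'.
under [in leRHS]eq_integral do rewrite E.
move: fin; under eq_integral do rewrite E; move=> fin.
set I := (\int[mu]_x maximal f x `^ _)%E in fin *.
have I0 : (0 <= I)%E by apply: integral_ge0 => x _; exact: poweR_ge0.
have Ifin : I \is a fin_num.
  by rewrite ge0_fin_numE//; apply: lty_poweRy fin.
have K0 : 0 <= finite_const B alpha C0 C1 C2 * (2 * B%:R).
  by rewrite mulr_ge0 ?finite_const_ge0.
rewrite -poweR_EFin -poweRM ?lee_fin//.
apply: le_poweR; first exact: ltW.
  by apply: integral_ge0 => x _; exact: poweR_ge0.
rewrite -(fineK Ifin) -EFinM.
apply: (integral_norlund_maximal hm hmu halpha hq_noninc hq_ge0 hq0 hq0C hQO hqO hmart).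
by rewrite fineK.
Qed.
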